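(* Let $M$ be a matroid with rank $r$ and let $H$ be a stressed hyperplane of $M$ with $|H|\geq r$. If $M$ is Ehrhart positive, then so is $\mathrm{Rel}_H(M)$.
   Context: For a matroid $M$ on a finite ground set $[n]=\{1,\dots,n\}$, its base polytope $\mathcal{P}_M\subset\mathbb{R}^n$ is the convex hull of the indicator vectors of its bases. The Ehrhart polynomial of a lattice polytope $P\subset\mathbb{R}^d$ is the polynomial in $t$ that agrees with $|tP\cap\mathbb{Z}^d|$ for all integers $t\ge0$. $M$ is Ehrhart positive if the Ehrhart polynomial of $\mathcal{P}_M$ has nonnegative coefficients. A hyperplane $H$ of a rank $r$ matroid $M$ is stressed if every subset of $H$ of size $r$ is a circuit of $M$. If $\mathcal{B}$ is the set of bases of $M$ and $H$ is a stressed hyperplane, then $\mathcal{B}\cup\binom{H}{r}$ (where $\binom{H}{r}$ is the set of $r$-element subsets of $H$) is known to be the set of bases of a matroid, denoted $\mathrm{Rel}_H(M)$ and called the relaxation of $M$ at $H$. *)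

(* Defs.v *)
From mathcomp Require Import mathcomp_extra boolp classical_sets functions.
From mathcomp Require Import cardinality reals convex.
From mathcomp Require Import all_boot all_order all_algebra.

Set Implicit Arguments.
Unset Strict Implicit.
Unset Printing Implicit Defensive.

Import Order.TTheory GRing.Theory Num.Theory.

(* The ground set [n] = {1, ..., n} is rendered as 'I_n = {0, ..., n - 1}. *)
Record matroid (n : nat) := Matroid {
  bases : {set {set 'I_n}};
  bases_neq0 : bases != set0;
  bases_exchange : forall (B1 B2 : {set 'I_n}) (x : 'I_n),
    B1 \in bases -> B2 \in bases -> x \in B1 :\: B2 ->
    exists2 y, y \in B2 :\: B1 & y |: (B1 :\ x) \in bases }.

Section MatroidNotions.
Variables (n : nat) (M : matroid n).
Implicit Types (A B C F H I : {set 'I_n}) (x y : 'I_n).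

Definition rank_of A : nat := \max_(B in bases M) #|A :&: B|.

Definition mrank : nat := rank_of [set: 'I_n].

Definition independent A : bool := [exists B in bases M, A \subset B].

Definition circuit C : bool :=
  minset (fun A : {set 'I_n} => ~~ independent A) C.

Definition flat F : bool :=
  [forall x, (x \notin F) ==> (rank_of F < rank_of (x |: F))].

(* Stated with a successor, so that a matroid of rank 0 has no hyperplane. *)
Definition hyperplane H : bool := flat H && ((rank_of H).+1 == mrank).

Definition stressed_hyperplane H : bool :=
  hyperplane H &&
  [forall C : {set 'I_n}, (C \subset H) && (#|C| == mrank) ==> circuit C].

Definition relaxation_bases H : {set {set 'I_n}} :=
  bases M :|: [set C : {set 'I_n} | C \subset H & #|C| == mrank].

Lemma bases_card_le B1 B2 :
  B1 \in bases M -> B2 \in bases M -> #|B1| <= #|B2|.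
Proof.
move=> + B2M; have [k] := ubnP #|B1 :\: B2|; elim: k B1 => // k IHk B1 ltk B1M.
have [/eqP|[x xD]] := set_0Vmem (B1 :\: B2).
  by rewrite setD_eq0 => /subset_leq_card.
have [y yD B3M] := bases_exchange B1M B2M xD.
move: xD yD; rewrite !in_setD => /andP[xB2 xB1] /andP[yB1 yB2].
have yNx : y \notin B1 :\ x by rewrite in_setD1 negb_and yB1 orbT.
suff /IHk/(_ B3M) : #|(y |: B1 :\ x) :\: B2| < k.
  by rewrite cardsU1 yNx (cardsD1 x B1) xB1.
apply: leq_trans (_ : #|B1 :\: B2| <= k) => //; apply: proper_card.
apply/properP; split.
  apply/subsetP => z; rewrite !inE => /andP[zB2] /orP[/eqP zy|].
    by rewrite zy yB2 in zB2.
  by rewrite zB2 => /andP[].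
exists x; rewrite ?inE ?xB1 ?xB2 ?eqxx //= orbF.
by apply: contraNneq xB2 => ->.
Qed.

Lemma bases_card B : B \in bases M -> #|B| = mrank.
Proof.
move=> BM; apply/eqP; rewrite eqn_leq; apply/andP; split.
  rewrite /mrank /rank_of -{1}(setTI B).
  exact: (leq_bigmax_cond (F := fun B : {set 'I_n} => #|[set: 'I_n] :&: B|) B).
by apply/bigmax_leqP => B' B'M; rewrite setTI bases_card_le.
Qed.

(* Completing [C :\ x], for a circuit [C], to a basis inside [B2]. *)
Lemma circuit_augment C x B2 :
    #|C| = mrank -> circuit C -> x \in C -> B2 \in bases M ->
  exists2 y, y \in B2 :\: (C :\ x) & y |: (C :\ x) \in bases M.
Proof.
move=> cardC /minsetP[_ minC] xC B2M.
have /existsP[B /andP[BM CxB]] : independent (C :\ x).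
  apply: contraT => /minC/(_ (subD1set C x)) CxC.
  by move: xC; rewrite -CxC setD11.
have cCx : #|C :\ x|.+1 = mrank by rewrite -cardC (cardsD1 x C) xC.
have /cards1P[z zE] : #|B :\: (C :\ x)| == 1.
  by rewrite cardsD (setIidPr CxB) (bases_card BM) -cCx subSnn.
have BE : B = z |: (C :\ x).
  by rewrite -zE -setUC -{1}(setID B (C :\ x)) (setIidPr CxB).
have zD : z \in B :\: (C :\ x) by rewrite zE inE.
move: (zD); rewrite in_setD => /andP[zC zB].
have [zB2|zB2] := boolP (z \in B2).
  by exists z; [rewrite in_setD zC | rewrite -BE].
have [|y yD yM] := bases_exchange BM B2M (x := z); first by rewrite in_setD zB2.
move: yD; rewrite in_setD => /andP[yB yB2]; exists y.
  by rewrite in_setD yB2 andbT; apply: contra yB => /(subsetP CxB).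
by rewrite BE setU1K in yM.
Qed.

Lemma relaxation_neq0 H : relaxation_bases H != set0.
Proof.
have /set0Pn[B BM] := bases_neq0 M.
by apply/set0Pn; exists B; rewrite inE BM.
Qed.

Lemma relaxation_exchange H : stressed_hyperplane H ->
  forall B1 B2 x, B1 \in relaxation_bases H -> B2 \in relaxation_bases H ->
    x \in B1 :\: B2 ->
  exists2 y, y \in B2 :\: B1 & y |: (B1 :\ x) \in relaxation_bases H.
Proof.
move=> /andP[/andP[/forallP flatH /eqP rkH] /forallP circH] B1 B2 x.
have circHE C : C \subset H -> #|C| = mrank -> circuit C.
  by move=> CH cC; have := circH C; rewrite CH cC eqxx.
have cardR B : B \in relaxation_bases H -> #|B| = mrank.
  by rewrite !inE => /orP[/bases_card //|/andP[_ /eqP]].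
move=> B1R B2R xD.
have inH : B1 :\ x \subset H -> B2 \subset H ->
    exists2 y, y \in B2 :\: B1 & y |: (B1 :\ x) \in relaxation_bases H.
  move=> B1H B2H; have /card_gt0P[y yD] : 0 < #|B2 :\: B1|.
    have : 0 < #|B1 :\: B2| by apply/card_gt0P; exists x.
    by rewrite !cardsD (cardR _ B1R) (cardR _ B2R) setIC.
  exists y => //; move: xD yD; rewrite !in_setD => /andP[_ xB1] /andP[yB1 yB2].
  rewrite !inE subUset sub1set (subsetP B2H) // B1H /= cardsU1 !inE.
  by rewrite (negPf yB1) andbF /= -(cardR _ B1R) (cardsD1 x B1) xB1 eqxx orbT.
have weak : (exists2 y, y \in B2 :\: B1 & y |: (B1 :\ x) \in bases M) ->
    exists2 y, y \in B2 :\: B1 & y |: (B1 :\ x) \in relaxation_bases H.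
  by case=> y yD yM; exists y => //; rewrite inE yM.
move: (xD); rewrite in_setD => /andP[xB2 xB1].
move: (B2R); rewrite !inE => /orP[B2M|/andP[B2H /eqP cB2]].
  move: (B1R); rewrite !inE => /orP[B1M|/andP[B1H /eqP cB1]].
    exact/weak/bases_exchange.
  apply: weak; have [y yD yM] := circuit_augment cB1 (circHE _ B1H cB1) xB1 B2M.
  exists y => //; move: yD; rewrite !inE => /andP[+ yB2]; rewrite yB2 andbT.
  by rewrite negb_and negbK => /orP[/eqP yx|//]; rewrite -yx yB2 in xB2.
have [B1H|/subsetPn[w wB1 wH]] := boolP (B1 :\ x \subset H); first exact: inH.
move: (B1R); rewrite !inE => /orP[B1M|/andP[B1H _]]; last first.
  by case/negP: wH; move: wB1; rewrite in_setD1 => /andP[_ /(subsetP B1H)].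
apply: weak.
have notH B : B \in bases M -> ~~ (B \subset H).
  move=> BM; apply/negP => /setIidPr BH.
  have : #|H :&: B| <= rank_of H.
    exact: (leq_bigmax_cond (F := fun B : {set 'I_n} => #|H :&: B|) B).
  by rewrite BH bases_card // -rkH ltnn.
have /card_gt0P[b bB2] : 0 < #|B2| by rewrite cB2 -rkH.
have [B3 B3M B3H] : exists2 B3, B3 \in bases M & B3 \subset w |: H.
  have Mpos : 0 < #|bases M| by rewrite card_gt0 bases_neq0.
  have := flatH w; rewrite wH rkH /= => rkw.
  have [B BM Bw] := eq_bigmax_cond (fun B : {set 'I_n} => #|(w |: H) :&: B|)
    Mpos.
  exists B => //; apply/setIidPr/eqP; rewrite eqEcard subsetIr /=.
  by rewrite (bases_card BM) -Bw.
have [y yD yM] := circuit_augment cB2 (circHE _ B2H cB2) bB2 B3M.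
have yw : y = w.
  move: yD; rewrite in_setD => /andP[_ /(subsetP B3H)].
  rewrite in_setU1 => /orP[/eqP //|yH]; have := notH _ yM.
  by rewrite subUset sub1set yH (subset_trans (subD1set _ _) B2H).
move: wB1 yM; rewrite {}yw in_setD1 => /andP[wx wB1] yM.
have [|z zD zM] := bases_exchange B1M yM (x := x).
  by rewrite !inE xB1 (negPf xB2) andbF orbF eq_sym wx.
exists z => //; move: zD; rewrite !inE => /andP[zB1].
rewrite zB1 => /orP[/eqP zw|/andP[] //].
by rewrite zw wB1 in zB1.
Qed.

Definition relaxation H (stressedH : stressed_hyperplane H) : matroid n :=
  Matroid (relaxation_neq0 H) (relaxation_exchange stressedH).

End MatroidNotions.

Local Open Scope classical_set_scope.
Local Open Scope card_scope.
Local Open Scope ring_scope.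

Section Ehrhart.
Variables (R : realType) (d : nat).
Implicit Types (P A : set 'rV[R]_d).

Definition convex_hull A : set 'rV[R]_d :=
  smallest (@convex_set R 'rV[R]_d) A.

Definition dilate (t : R) P : set 'rV[R]_d := [set t *: v | v in P].

Definition lattice_points P : set 'rV[R]_d :=
  [set v | P v /\ forall i, v ord0 i \is a Num.int].

(* [A #= `I_k] says that [A] is finite with exactly [k] elements. *)
Definition is_ehrhart_polynomial P (p : {poly R}) : Prop :=
  forall t : nat, exists2 k : nat,
    lattice_points (dilate t%:R P) #= `I_k & p.[t%:R] = k%:R.

End Ehrhart.

Section EhrhartPositive.
Variables (R : realType) (n : nat) (M : matroid n).

Definition indicator (B : {set 'I_n}) : 'rV[R]_n := \row_i (i \in B)%:R.

Definition base_polytope : set 'rV[R]_n :=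
  convex_hull [set indicator B | B in [set` bases M]].

(* A polynomial is determined by its values on the naturals, so there is at
   most one [p] as below; Ehrhart's theorem provides its existence. *)
Definition ehrhart_positive : Prop :=
  exists2 p : {poly R}, is_ehrhart_polynomial base_polytope p &
    forall i : nat, 0 <= p`_i.

End EhrhartPositive.

(* Main.v *)
Require Import Defs.
From mathcomp Require Import all_boot all_order all_algebra finmap.
From mathcomp Require Import classical_sets cardinality reals convex.
From mathcomp Require Import interval_inference ring lra zify.

(* Every [r]-subset meeting [H] in [r - 1] elements is a basis of [M], so the
   relaxation adds to the base polytope exactly the slice [x(H) > r - 1] of the
   hypersimplex. With [h = |H|] and [m = n - h], the number of lattice points of
   the [t]-th dilate thus grows by the sum over [s < t] of
   ['C(s + m - 1, m - 1) * f s], where [f s] counts the points of [{0..t}^h] with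
   coordinate sum [r t - s]. Up to the factor ['C(t + m - 1, m)] these weights
   are the beta integrals over [0 <= w <= 1] of
   [m w^(m - 1) 'C(t - 1, s) w^s (1 - w)^(t - 1 - s)], so it suffices to treat
   binomial weights. By inclusion-exclusion the binomially weighted sum of [f]
   is the coefficient of [x^(r - 1) Y^(h - 1)] in
     [sum_i x^i (1 - x) (1 - x Y)^(i t) (1 - c Y)^(t - 1)
        / (1 - Y)^((i + 1) t + 1)],
   where [c = w + x (1 - w)]. The logarithmic derivative in [Y] of
   [(1 - x Y)^(i t) (1 - c Y)^t / (1 - Y)^((i + 1) t)] is
   [(1 - x) t (i a + (i + 1) b)], where [a] and [b] have nonnegative coefficients
   in [x], [w] and [1 - w]. So only the series
   [(1 - x)^(p + q + 1) sum_i i^p (i + 1)^q x^i] remain, and these are polynomials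
   with nonnegative coefficients of Eulerian type. *)

Set Implicit Arguments.
Unset Strict Implicit.
Unset Printing Implicit Defensive.

Import Order.TTheory GRing.Theory Num.Theory.

Local Open Scope ring_scope.

(** * Congruence of polynomials modulo a power of the variable *)

Section EqX.
Variable A : comNzRingType.
Implicit Types p q : {poly A}.

Definition eqX N p q := forall k, (k < N)%N -> p`_k = q`_k.

Lemma eqX_refl N p : eqX N p p. Proof. by []. Qed.

Lemma eqX_sym N p q : eqX N p q -> eqX N q p.
Proof. by move=> e k kN; rewrite e. Qed.

Lemma eqX_trans N p q s : eqX N p q -> eqX N q s -> eqX N p s.
Proof. by move=> e f k kN; rewrite e // f. Qed.

Lemma eqX_le M N p q : (M <= N)%N -> eqX N p q -> eqX M p q.
Proof. by move=> MN e k kM; apply: e; apply: leq_trans MN. Qed.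

Lemma eqXD N p q p' q' : eqX N p q -> eqX N p' q' -> eqX N (p + p') (q + q').
Proof. by move=> e f k kN; rewrite !coefD e // f. Qed.

Lemma eqXM N p q p' q' : eqX N p q -> eqX N p' q' -> eqX N (p * p') (q * q').
Proof.
move=> e f k kN; rewrite !coefM; apply: eq_bigr => i _.
by rewrite e ?f //; have := ltn_ord i; lia.
Qed.

Lemma eqXX N p q n : eqX N p q -> eqX N (p ^+ n) (q ^+ n).
Proof.
by move=> e; elim: n => [//|n IHn]; rewrite !exprS; apply: eqXM.
Qed.

Lemma eqX_deriv N p q : eqX N.+1 p q -> eqX N p^`() q^`().
Proof. by move=> e k kN; rewrite !coef_deriv e. Qed.

Lemma eqX_mulX N p q : eqX N p q -> eqX N.+1 ('X * p) ('X * q).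
Proof. by move=> e [|k] kN; rewrite !coefXM //= e. Qed.

(* The truncation of [1 / (1 - a X)]. *)
Definition geo N (a : A) : {poly A} := \poly_(l < N) a ^+ l.

Lemma geoE N a : (1 - a *: 'X) * geo N a = 1 - a ^+ N *: 'X^N.
Proof.
apply/polyP => k; rewrite mulrBl mul1r -scalerAl !coefE.
case: k => [|k] /=.
  by case: N => [|N]; rewrite ?expr0 ?mulr0 ?mulr1 ?subr0 ?subrr //= mulr0 subr0.
case: (ltngtP k.+1 N) => kN; rewrite ?mulr0 ?mulr1 ?subr0.
- by rewrite exprS subrr.
- by [].
- by rewrite -kN exprS.
Qed.

Lemma eqX_geo N a : eqX N ((1 - a *: 'X) * geo N a) 1.
Proof.
by move=> k kN; rewrite geoE !coefE (ltn_eqF kN) mulr0 subr0.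
Qed.

(** Below degree [N] this is 1 / (1 - X)^n; the induction on [n] sums along a diagonal of Pascal's
    triangle. At [n = 0], ['C(l.-1, l)] is 1 for [l = 0] and 0 otherwise. *)
Lemma coef_geoX N n l : (l < N)%N -> (geo N 1 ^+ n)`_l = 'C((n + l).-1, l)%:R.
Proof.
elim: n l => [|n IHn] l lN.
  by rewrite expr0 add0n coef1; case: l {lN} => [//|l]; rewrite bin_small.
rewrite exprSr coefM.
transitivity (\sum_(j < l.+1) 'C((n + j).-1, j)%:R : A).
  apply: eq_bigr => j _; rewrite IHn; last by have := ltn_ord j; lia.
  by rewrite coef_poly expr1n ifT ?mulr1 //; have := ltn_ord j; lia.
elim: l {lN} => [|l IHl]; first by rewrite big_ord1 !bin0.
by rewrite big_ord_recr /= IHl -natrD !addSn !addnS /= binS addnC.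
Qed.

(** The logarithmic derivative of (1 - a X)^n is - n a / (1 - a X), and [geo N a] stands for 1 / (1
    - a X). *)
Lemma deriv_lin_exp a n N :
  eqX N ((1 - a *: 'X) ^+ n)^`() (- n%:R%:P * (a *: geo N a) * (1 - a *: 'X) ^+ n).
Proof.
case: n => [|n].
  by rewrite expr0 -polyC1 derivC oppr0 !mul0r; apply: eqX_refl.
set L := 1 - a *: 'X.
have -> : (L ^+ n.+1)^`() = - n.+1%:R%:P * a%:P * L ^+ n * 1.
  have dL : L^`() = - a%:P.
    by rewrite derivB derivZ derivX -polyC1 derivC sub0r -mul_polyC polyC1 mulr1.
  by rewrite deriv_exp dL /= -mulr_natl polyC_natr; ring.
have -> : - n.+1%:R%:P * (a *: geo N a) * L ^+ n.+1
   = - n.+1%:R%:P * a%:P * L ^+ n * (L * geo N a).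
  by rewrite -mul_polyC exprS; ring.
by apply: eqXM; [apply: eqX_refl | apply/eqX_sym/eqX_geo].
Qed.

(** The logarithmic derivative of 1 / (1 - X)^n is n / (1 - X). Differentiation costs one order of
    precision, hence the powers of [geo N.+1 1]. *)
Lemma deriv_geo_exp n N :
  eqX N (geo N.+1 1 ^+ n)^`() (n%:R%:P * geo N 1 * geo N.+1 1 ^+ n).
Proof.
have le1 : eqX N (geo N.+1 1) (geo N 1).
  by move=> k kN; rewrite !coef_poly kN (leqW kN).
have dgeo : eqX N (geo N.+1 1)^`() (geo N 1 ^+ 2).
  move=> k kN; rewrite coef_geoX // coef_deriv coef_poly ltnS kN expr1n.
  by rewrite add2n /= binSn.
case: n => [|n].
  by rewrite expr0 -polyC1 derivC !mul0r; apply: eqX_refl.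
rewrite deriv_exp /=.
have -> : n.+1%:R%:P * geo N 1 * geo N.+1 1 ^+ n.+1
   = n.+1%:R%:P * (geo N.+1 1 ^+ n * (geo N 1 * geo N.+1 1)).
  by rewrite exprS; ring.
rewrite -mulr_natl polyC_natr.
apply: eqXM; first exact: eqX_refl.
rewrite [in X in eqX N X]mulrC.
apply: eqXM; first exact: eqX_refl.
apply: eqX_trans dgeo _; rewrite expr2.
by apply: eqXM; [exact: eqX_refl | apply: eqX_sym].
Qed.

End EqX.

(** * Polynomials of Eulerian type *)

Section Euler.
Variable A : comNzRingType.

(** The operator X d/dX multiplies the coefficient of X^i by i; applied to E / (1 - X)^(d + 1) it
    yields the right-hand side over (1 - X)^(d + 2). The factor X restores the order of precision
    lost by the derivative. *)
Lemma eqX_euler_step N d (F E : {poly A}) :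
  eqX N ((1 - 'X) ^+ d.+1 * F) E ->
  eqX N ((1 - 'X) ^+ d.+2 * ('X * F^`()))
    ('X * ((1 - 'X) * E^`() + d.+1%:R * E)).
Proof.
case: N => [//|N] eqFE.
have -> : (1 - 'X) ^+ d.+2 * ('X * F^`())
  = 'X * ((1 - 'X) * ((1 - 'X) ^+ d.+1 * F)^`()
          + d.+1%:R * ((1 - 'X) ^+ d.+1 * F)).
  have d1X : (1 - 'X : {poly A})^`() = - 1.
    by rewrite derivB derivX -polyC1 derivC sub0r.
  by rewrite derivM deriv_exp d1X /= !exprS -mulr_natl; ring.
apply: eqX_mulX; apply: eqXD; apply: eqXM => //.
  exact: eqX_deriv.
exact: eqX_le eqFE.
Qed.

(** The generating series of [f] is a numerator over (1 - X)^(d + 1). Natural coefficients lie in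
    every cone used below, and the degree bound [d] keeps the recurrences free of negative terms. *)
Definition eulerian d (f : nat -> nat) := exists2 e : nat -> nat,
  forall k, (d < k)%N -> e k = 0%N &
  forall N, eqX N ((1 - 'X) ^+ d.+1 * \poly_(i < N) (f i)%:R)
    (\poly_(k < N) (e k)%:R : {poly A}).

(** Truncated subtraction agrees with that of the ring because [a] vanishes wherever truncation
    occurs. *)
Lemma natr_step d k a : (d < k -> a = 0)%N ->
  ((d - k) * a)%:R = (d%:R - k%:R) * a%:R :> A.
Proof.
move=> a0; have [kd|dk] := leqP k d; last by rewrite a0 // !mulr0 muln0.
by rewrite natrM natrB.
Qed.

Lemma mulX_deriv_poly N (f : nat -> nat) :
  'X * (\poly_(i < N) (f i)%:R)^`() = \poly_(i < N) (i * f i)%:R :> {poly A}.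
Proof.
apply/polyP => -[|k]; rewrite coefXM coef_poly /= ?mul0n ?if_same //.
by rewrite coef_deriv coef_poly; case: ifP => _; rewrite ?mul0rn // -mulrnA mulnC.
Qed.

Lemma eulerianM d f : eulerian d f -> eulerian d.+1 (fun i => i * f i)%N.
Proof.
move=> [e e0 eE].
(* The recurrence of the Eulerian numbers, read off from X ((1 - X) E' + (d + 1) E). *)
exists (fun k => if k is k'.+1 then k * e k + (d.+1 - k') * e k' else 0)%N.
  by case=> // k dk; rewrite !e0 ?muln0 //; lia.
move=> N; rewrite -mulX_deriv_poly.
apply: eqX_trans (eqX_euler_step (eE N)) _ => -[|k] kN;
  rewrite coefXM coef_poly kN //=.
rewrite coefD mulrBl mul1r coefB coefXM mulr_natl coefMn.
rewrite !coef_deriv !coef_poly kN (ltnW kN) -mulr_natr -[_ *+ d.+1]mulr_natr.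
have dk : (d.+1 < k -> e k = 0)%N by move=> dk; apply: e0; lia.
rewrite natrD (natr_step dk) natrM -!natr1.
case: k {dk} kN => [|k] kN /=; first by ring.
by rewrite (ltnW kN) -[_ *+ k.+1]mulr_natr -!natr1; ring.
Qed.

Lemma eulerianS d f :
  eulerian d f -> eulerian d.+1 (fun i => i.+1 * f i)%N.
Proof.
move=> [e e0 eE].
(* Multiplication by [i.+1] is F + X F', so these are the coefficients of (1 - X) E + X ((1 - X) E'
   + (d + 1) E). *)
exists (fun k => if k is k'.+1 then k.+1 * e k + (d - k') * e k' else e k)%N.
  by case=> // k dk; rewrite !e0 ?muln0 //; lia.
move=> N; have -> : \poly_(i < N) (i.+1 * f i)%:R =
    \poly_(i < N) (f i)%:R + 'X * (\poly_(i < N) (f i)%:R)^`() :> {poly A}.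
  rewrite mulX_deriv_poly; apply/polyP => k; rewrite coefD !coef_poly mulSn.
  by case: ifP => _; rewrite ?addr0 // natrD.
rewrite mulrDr exprS -mulrA; apply: eqX_trans.
  apply: eqXD; last exact: eqX_euler_step (eE N).
  by apply: (@eqXM _ N (1 - 'X)) (eE N).
move=> k kN; rewrite coefD coefXM mulrBl mul1r coefB coefXM !coef_poly kN.
case: k kN => [|k] kN; first by rewrite subr0 addr0.
rewrite /= coefD mulrBl mul1r coefB coefXM mulr_natl coefMn.
rewrite !coef_deriv !coef_poly kN (ltnW kN) -mulr_natr -[_ *+ d.+1]mulr_natr.
have dk : (d < k -> e k = 0)%N by move=> dk; apply: e0; lia.
rewrite natrD (natr_step dk) natrM -!natr1.
case: k {dk} kN => [|k] kN /=; first by ring.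
by rewrite (ltnW kN) -[_ *+ k.+1]mulr_natr -!natr1; ring.
Qed.

Lemma eulerian_exp p q : eulerian (p + q) (fun i => i ^ p * i.+1 ^ q)%N.
Proof.
elim: p => [|p [e e0 eE]]; last first.
  have [e' e'0 e'E] := eulerianM (ex_intro2 _ _ e e0 eE).
  exists e' => // N; apply: eqX_trans (e'E N).
  by apply: eqXM => // k kN; rewrite !coef_poly expnS mulnA.
elim: q => [|q [e e0 eE]].
  exists (fun k => (k == 0)%N : nat); first by case.
  move=> N k kN; rewrite expr1 coef_poly kN.
  rewrite mulrBl mul1r coefB coefXM !coef_poly kN !expn0 muln1.
  by case: k kN => [|k] kN /=; rewrite ?subr0 // (ltnW kN) subrr.
have [e' e'0 e'E] := eulerianS (ex_intro2 _ _ e e0 eE).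
exists e' => // N; apply: eqX_trans (e'E N).
by apply: eqXM => // k kN; rewrite !coef_poly !expn0 !mul1n expnS.
Qed.
End Euler.

(** * A power series with positive logarithmic derivative *)

Section LogDerivative.
Variables (B : comNzRingType) (x w : B).
Let c := w + x * (1 - w).

(* [(1 - x Y)^n (1 - c Y)^t / (1 - Y)^(n + t)], correct up to degree [N]. *)
Definition rat_series N n t : {poly B} :=
  (1 - x *: 'X) ^+ n * (1 - c *: 'X) ^+ t * geo N.+1 1 ^+ (n + t).

Lemma rat_series0 N n t : (rat_series N n t)`_0 = 1.
Proof.
rewrite -horner_coef0 !hornerM !horner_exp !hornerE ?mulr0 ?subr0 ?expr1n ?mul1r.
by rewrite horner_coef0 coef_poly expr0 expr1n.
Qed.

Lemma log_derivative_rat_series N n t : eqX N (rat_series N n t)^`()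
  (rat_series N n t * (n%:R%:P * (geo N 1 - x *: geo N x)
                       + t%:R%:P * (geo N 1 - c *: geo N c))).
Proof.
rewrite /rat_series !derivM.
set X := (1 - x *: 'X) ^+ n; set Y := (1 - c *: 'X) ^+ t; set Z := geo _ 1 ^+ _.
have := eqXD (eqXM (eqXD (eqXM (@deriv_lin_exp B x n N) (@eqX_refl _ N Y))
  (eqXM (@eqX_refl _ N X) (@deriv_lin_exp B c t N))) (@eqX_refl _ N Z))
  (eqXM (@eqX_refl _ N (X * Y)) (@deriv_geo_exp B (n + t) N)).
move=> H; apply: eqX_trans H _ => k _; congr ((polyseq _)`_k).
by rewrite -/X -/Y -/Z natrD polyCD -!mul_polyC; ring.
Qed.

(** The coefficient n (1 - x^(l + 1)) + t (1 - c^(l + 1)) of the logarithmic derivative, regrouped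
    as n (c^(l + 1) - x^(l + 1)) + (n + t) (1 - c^(l + 1)). Then c - x = (1 - x) w and 1 - c = (1 -
    x) (1 - w) give the common factor [1 - x]. *)
Definition rat_log_coef n t l : B := (1 - x) *
  (n%:R * (w * \sum_(a < l.+1) c ^+ (l - a) * x ^+ a)
   + (n + t)%:R * ((1 - w) * \sum_(a < l.+1) c ^+ a)).

Lemma rat_series_rec N n t k : (k < N)%N ->
  (rat_series N n t)`_k.+1 *+ k.+1
  = \sum_(l < k.+1) (rat_series N n t)`_(k - l) * rat_log_coef n t l.
Proof.
move=> kN; rewrite -coef_deriv log_derivative_rat_series // coefMr.
apply: eq_bigr => l _; congr (_ * _).
have lN : (l < N)%N by have := ltn_ord l; lia.
rewrite coefD !coefCM !coefB !coefZ !coef_poly lN -!exprS expr1n.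
have ce : 1 - c ^+ l.+1 = (1 - x) * ((1 - w) * \sum_(a < l.+1) c ^+ a).
  by rewrite -opprB subrX1 /c; ring.
have xe : c ^+ l.+1 - x ^+ l.+1
    = (1 - x) * (w * \sum_(a < l.+1) c ^+ (l - a) * x ^+ a).
  by rewrite subrXX /c /=; ring.
transitivity (n%:R * (c ^+ l.+1 - x ^+ l.+1) + (n + t)%:R * (1 - c ^+ l.+1)).
  by rewrite natrD; ring.
by rewrite xe ce /rat_log_coef; ring.
Qed.

End LogDerivative.

(** * Positivity of the sums over [i], relative to a cone of coefficients *)

Section Cone.
Variables (A : comNzRingType) (C : A -> Prop) (w : A).
Hypotheses (C0 : C 0) (C1 : C 1).
Hypotheses (CD : forall a b, C a -> C b -> C (a + b)).
Hypotheses (CM : forall a b, C a -> C b -> C (a * b)).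
Hypotheses (Cw : C w) (C1w : C (1 - w)).

(** [C] plays the role of the nonnegative elements. It will be a cone of polynomials in [w], so that
    positivity is known before integrating over [w]. *)
Definition coneX (p : {poly A}) := forall k, C p`_k.

Lemma cone_sum (I : Type) (s : seq I) (F : I -> A) :
  (forall i, C (F i)) -> C (\sum_(i <- s) F i).
Proof. by move=> CF; elim/big_ind: _. Qed.

Lemma cone_nat n : C n%:R.
Proof. by elim: n => [//|n IHn]; rewrite -natr1; apply: CD. Qed.

Lemma coneXC a : C a -> coneX a%:P.
Proof. by move=> Ca k; rewrite coefC; case: eqP. Qed.

Lemma coneXX : coneX 'X.
Proof. by move=> k; rewrite coefX; case: eqP. Qed.

Lemma coneXD p q : coneX p -> coneX q -> coneX (p + q).
Proof. by move=> Cp Cq k; rewrite coefD; apply: CD. Qed.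

Lemma coneXM p q : coneX p -> coneX q -> coneX (p * q).
Proof.
by move=> Cp Cq k; rewrite coefM; apply: cone_sum => i; apply: CM.
Qed.

Lemma coneX_exp p n : coneX p -> coneX (p ^+ n).
Proof.
move=> Cp; elim: n => [|n IHn]; first by rewrite expr0 -polyC1; apply: coneXC.
by rewrite exprS; apply: coneXM.
Qed.

Lemma coneX_sum (I : Type) (s : seq I) (F : I -> {poly A}) :
  (forall i, coneX (F i)) -> coneX (\sum_(i <- s) F i).
Proof. by move=> CF k; rewrite coef_sum; apply: cone_sum => i; apply: CF. Qed.

Lemma coneX_natM n p : coneX p -> coneX (n%:R * p).
Proof.
by move=> Cp; apply: coneXM Cp; rewrite -polyC_natr; apply/coneXC/cone_nat.
Qed.

(* The exponents [p] and [q] make the property stable under multiplication by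
   [(1 - x) i t] and [(1 - x) (i + 1) t], the two factors of [rat_log_coef]. *)
Definition positive_sum (z : nat -> nat -> {poly A}) := forall r p q kappa,
  coneX kappa -> exists2 P, coneX P & forall t, P.[t%:R] =
    (kappa * \sum_(i < r.+1) 'X^i *
      ((1 - 'X) ^+ (p + q).+1 * (i ^ p * i.+1 ^ q * t ^ (p + q))%:R * z i t))`_r.

Lemma eq_positive_sum z1 z2 : (forall i t, z1 i t = z2 i t) ->
  positive_sum z1 -> positive_sum z2.
Proof.
move=> z12 z1P r p q kappa Ck; have [P CP PE] := z1P r p q kappa Ck.
exists P => // t; rewrite PE; congr ((polyseq (_ * _))`_r).
by apply: eq_bigr => i _; rewrite z12.
Qed.

(** The sum over [i] is an Eulerian numerator up to degree [r], so only a multiple of t^(p + q) by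
    an element of the cone remains. *)
Lemma positive_sum1 : positive_sum (fun _ _ => 1).
Proof.
move=> r p q kappa Ck; have [e _ eE] := eulerian_exp A p q.
pose a := (kappa * \poly_(k < r.+1) (e k)%:R)`_r.
exists (a *: 'X^(p + q)).
  move=> k; rewrite coefZ coefXn mulr_natr; case: eqP => _ //.
  by apply: coneXM => // j; rewrite coef_poly; case: ifP => // _; apply: cone_nat.
move=> t; rewrite hornerZ hornerXn /a.
have <- := eqXM (@eqX_refl _ r.+1 kappa) (eE r.+1) (ltnSn r).
rewrite poly_def mulrC -[_ ^+ _ * _`_r]coefCM; congr ((polyseq _)`_r).
rewrite mulrCA; congr (_ * _); rewrite mulrCA 2!mulr_sumr; apply: eq_bigr => i _.
by rewrite polyC_exp !polyC_natr -mul_polyC polyC_natr !natrM !natrX; ring.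
Qed.

Lemma positive_sumD z1 z2 : positive_sum z1 -> positive_sum z2 ->
  positive_sum (fun i t => z1 i t + z2 i t).
Proof.
move=> z1P z2P r p q kappa Ck.
have [P CP PE] := z1P r p q kappa Ck; have [Q CQ QE] := z2P r p q kappa Ck.
exists (P + Q); first exact: coneXD.
move=> t; rewrite hornerD PE QE -coefD -mulrDr -big_split /=.
congr ((polyseq (_ * _))`_r).
by apply: eq_bigr => i _; rewrite !mulrDr.
Qed.

Lemma positive_sum0 : positive_sum (fun _ _ => 0).
Proof.
move=> r p q kappa Ck; exists 0; first by move=> k; rewrite coef0.
by move=> t; rewrite horner0 big1 ?mulr0 ?coef0 // => i _; rewrite !mulr0.
Qed.

(** The factor is absorbed into the universally quantified [kappa] of [positive_sum]. *)
Lemma positive_sumM z kappa : coneX kappa -> positive_sum z ->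
  positive_sum (fun i t => kappa * z i t).
Proof.
move=> Ck zP r p q kappa' Ck'.
have [P CP PE] := zP r p q (kappa' * kappa) (coneXM Ck' Ck).
exists P => // t; rewrite PE -[in LHS]mulrA mulr_sumr.
congr ((polyseq (_ * _))`_r).
by apply: eq_bigr => i _; ring.
Qed.

Lemma positive_sumMi z : positive_sum z ->
  positive_sum (fun i t => (1 - 'X) * (i * t)%:R * z i t).
Proof.
move=> zP r p q kappa Ck; have [P CP PE] := zP r p.+1 q kappa Ck.
exists P => // t; rewrite PE; congr ((polyseq (_ * _))`_r).
by apply: eq_bigr => i _; rewrite addSn !expnS exprS !natrM; ring.
Qed.

Lemma positive_sumMiS z : positive_sum z ->
  positive_sum (fun i t => (1 - 'X) * (i.+1 * t)%:R * z i t).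
Proof.
move=> zP r p q kappa Ck; have [P CP PE] := zP r p q.+1 kappa Ck.
exists P => // t; rewrite PE; congr ((polyseq (_ * _))`_r).
by apply: eq_bigr => i _; rewrite addnS !expnS exprS !natrM; ring.
Qed.

Lemma positive_sum_sum (I : Type) (s : seq I) (F : I -> nat -> nat -> {poly A}) :
  (forall j, positive_sum (F j)) ->
  positive_sum (fun i t => \sum_(j <- s) F j i t).
Proof.
move=> FP; elim: s => [|j s IHs].
  by apply: eq_positive_sum positive_sum0 => i t; rewrite big_nil.
apply: eq_positive_sum (positive_sumD (FP j) IHs) => i t.
by rewrite big_cons.
Qed.

Let c : {poly A} := w%:P + 'X * (1 - w%:P).

Lemma coneX_1w : coneX (1 - w%:P).
Proof. by rewrite -polyC1 -polyCB; apply: coneXC. Qed.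

Lemma coneXc : coneX c.
Proof.
apply: coneXD; first exact: coneXC.
by apply: coneXM; [apply: coneXX | apply: coneX_1w].
Qed.

(** For [n = i * t] the two multipliers are (1 - x) i t and (1 - x) (i + 1) t; what they multiply is
    built from x, w, 1 - w and [c], all in the cone. *)
Lemma positive_sum_log_coef z l : positive_sum z -> positive_sum (fun i t =>
  z i t * rat_log_coef 'X w%:P (i * t) t l).
Proof.
move=> zP.
have k1 : coneX (w%:P * \sum_(a < l.+1) c ^+ (l - a) * 'X ^+ a).
  apply: coneXM; first exact: coneXC.
  apply: coneX_sum => a; apply: coneXM; apply: coneX_exp.
    exact: coneXc.
  exact: coneXX.
have k2 : coneX ((1 - w%:P) * \sum_(a < l.+1) c ^+ a).
  apply: coneXM; first exact: coneX_1w.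
  by apply: coneX_sum => a; apply/coneX_exp/coneXc.
apply: eq_positive_sum (positive_sumD (positive_sumM k1 (positive_sumMi zP))
  (positive_sumM k2 (positive_sumMiS zP))) => i t.
by rewrite /rat_log_coef -/c (_ : (i * t + t = i.+1 * t)%N); [ring | lia].
Qed.

(** Strong induction along [rat_series_rec]; the factor k! replaces the divisions that the recursion
    would require. *)
Lemma positive_sum_rat_series N k : (k <= N)%N -> positive_sum (fun i t =>
  k`!%:R * (rat_series 'X w%:P N (i * t) t)`_k).
Proof.
elim/ltn_ind: k => -[|k] IHk kN.
  apply: eq_positive_sum positive_sum1 => i t.
  by rewrite rat_series0 fact0 mulr1.
pose F (l : 'I_k.+1) i t := (k ^_ l)%:R *
  ((k - l)`!%:R * (rat_series 'X w%:P N (i * t) t)`_(k - l)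
    * rat_log_coef 'X w%:P (i * t) t l).
apply: (@eq_positive_sum (fun i t => \sum_l F l i t)) => [i t|].
  rewrite factS mulnC natrM -mulrA [k.+1%:R * _]mulr_natl.
  rewrite rat_series_rec // mulr_sumr.
  apply: eq_bigr => l _; rewrite /F -(@ffact_fact k l); last by rewrite -ltnS.
  by rewrite natrM; ring.
apply: positive_sum_sum => l; apply: positive_sumM.
  by rewrite -polyC_natr; apply/coneXC/cone_nat.
by apply: positive_sum_log_coef; apply: IHk; lia.
Qed.

(** The new factor 1 / ((1 - c Y) (1 - Y)) adjusts the exponents to t - 1 and (i + 1) t + 1; its
    coefficients are sums of powers of [c], hence in the cone. *)
Lemma positive_sum_weighted N k : (k <= N)%N -> positive_sum (fun i t =>
  k`!%:R * (rat_series 'X w%:P N (i * t) t * (geo N.+1 c * geo N.+1 1))`_k).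
Proof.
move=> kN; pose F (l : 'I_k.+1) i t :=
  ((k ^_ l)%:R * (geo N.+1 c * geo N.+1 1)`_l) *
  ((k - l)`!%:R * (rat_series 'X w%:P N (i * t) t)`_(k - l)).
apply: (@eq_positive_sum (fun i t => \sum_l F l i t)) => [i t|].
  rewrite coefMr mulr_sumr; apply: eq_bigr => l _.
  rewrite /F -(@ffact_fact k l); last by rewrite -ltnS.
  by rewrite natrM; ring.
apply: positive_sum_sum => l; apply: positive_sumM; last first.
  by apply: positive_sum_rat_series; lia.
apply: coneX_natM; rewrite coefM; apply: coneX_sum => j.
have -> : (geo N.+1 c)`_j = c ^+ j.
  by rewrite coef_poly ifT //; have := ltn_ord j; have := ltn_ord l; lia.
have -> : (geo N.+1 1)`_(l - j) = 1 ^+ (l - j) :> {poly A}.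
  by rewrite coef_poly ifT //; have := ltn_ord j; have := ltn_ord l; lia.
rewrite expr1n mulr1; apply/coneX_exp/coneXc.
Qed.

End Cone.

(** * Lattice points of a box with given coordinate sum *)

(** Multiplied by (j + 1)! d! b! (j + b + 1) and divided by (b + j + d)!, this is (j + d + 1) (j + b
    + 1) = b d + (j + 1) (b + j + d + 1). *)
Lemma bin_split j d b :
  ('C(j + d + 1, j.+1) * 'C(b + j + d, j + d) =
   (if d is d'.+1 then 'C(j + b, j.+1) * 'C(b + j + d, d') else 0)
   + 'C(j + b, j) * 'C(j + b + 1 + d, d))%N.
Proof.
set T1 := (X in (_ = X + _)%N).
have pos : (0 < j.+1`! * d`! * b`! * (j + b + 1))%N.
  by rewrite !muln_gt0 !fact_gt0 addn1.
apply/eqP; rewrite -(eqn_pmul2r pos) mulnDl; apply/eqP.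
have l1 : ('C(j + d + 1, j.+1) * (j.+1`! * d`!) = (j + d).+1 * (j + d)`!)%N.
  rewrite -factS -(@bin_fact (j + d).+1 j.+1) ?ltnS ?leq_addr //.
  by rewrite addn1 (_ : ((j + d).+1 - j.+1 = d)%N) //; lia.
have l2 : ('C(b + j + d, j + d) * ((j + d)`! * b`!) = (b + j + d)`!)%N.
  rewrite -(@bin_fact (b + j + d) (j + d)); last by lia.
  by rewrite (_ : (b + j + d - (j + d) = b)%N) //; lia.
have r2 : ('C(j + b, j) * (j`! * b`!) = (j + b)`!)%N.
  rewrite -(@bin_fact (j + b) j); last by lia.
  by rewrite (_ : (j + b - j = b)%N) //; lia.
have r3 : ('C(j + b + 1 + d, d) * (d`! * ((j + b).+1 * (j + b)`!)) =
           (b + j + d).+1 * (b + j + d)`!)%N.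
  rewrite -!factS -(@bin_fact (b + j + d).+1 d); last by lia.
  rewrite (_ : (j + b + 1 + d = (b + j + d).+1)%N); last by lia.
  by rewrite (_ : ((b + j + d).+1 - d = (j + b).+1)%N) //; lia.
have r1 : (T1 * (j.+1`! * d`! * b`! * (j + b + 1)) = b * d * (b + j + d)`!)%N.
  rewrite /T1; case: d {pos l1 l2 r3 T1} => [|d]; first by rewrite !mul0n muln0.
  case: b r2 => [|b] r2; first by rewrite addn0 bin_small.
  have e1 : ('C(j + b.+1, j.+1) * (j.+1`! * b`!) = (j + b.+1)`!)%N.
    rewrite -(@bin_fact (j + b.+1) j.+1); last by lia.
    by rewrite (_ : (j + b.+1 - j.+1 = b)%N) //; lia.
  have e2 : ('C(b.+1 + j + d.+1, d) * (d`! * ((j + b.+1 + 1) * (j + b.+1)`!)) =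
             (b.+1 + j + d.+1)`!)%N.
    rewrite -(@bin_fact (b.+1 + j + d.+1) d); last by lia.
    rewrite (_ : (b.+1 + j + d.+1 - d = (j + b.+1).+1)%N); last by lia.
    by rewrite factS addn1.
  rewrite -e2 -e1 (factS d) (factS b); ring.
rewrite r1.
transitivity ('C(j + d + 1, j.+1) * (j.+1`! * d`!) * 'C(b + j + d, j + d)
  * b`! * (j + b + 1))%N; first by ring.
rewrite l1; transitivity ((j + d).+1 * (j + b + 1)
  * ('C(b + j + d, j + d) * ((j + d)`! * b`!)))%N; first by ring.
rewrite l2 factS.
transitivity (b * d * (b + j + d)`! + 'C(j + b, j) * (j`! * b`!) *
  'C(j + b + 1 + d, d) * d`! * j.+1 * (j + b + 1))%N; last by ring.
rewrite r2; transitivity (b * d * (b + j + d)`! + j.+1 *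
  ('C(j + b + 1 + d, d) * (d`! * ((j + b).+1 * (j + b)`!))))%N; last by ring.
rewrite r3; ring.
Qed.

Section BoxCount.
Variable A : comNzRingType.

Lemma coef_linX (x : A) n j : ((1 - x *: 'X) ^+ n)`_j = 'C(n, j)%:R * (- x) ^+ j.
Proof.
elim: n j => [|n IHn] j; 
  first by rewrite expr0 coef1; case: j => [|j]; rewrite ?mulr1 ?mul0r.
rewrite exprS mulrBl mul1r -scalerAl coefB coefZ coefXM !IHn.
case: j => [|j] /=; first by rewrite !bin0 mulr0 subr0.
by rewrite binS natrD exprS; ring.
Qed.

(* [bin_split] compares the coefficients of [x^j]. *)
Lemma sum_bin_linX (x : A) u k N : (k < N)%N ->
  \sum_(j < k.+2) (- x) ^+ j * ('C(k.+1, j) * 'C(u.+1 + k - j, k))%:R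
  = (1 - x) * ((1 - x *: 'X) ^+ u * geo N 1 ^+ u.+2)`_k.
Proof.
move=> kN.
(* The coefficient of (- x)^j, cut off beyond [k]; multiplying by [1 - x] turns it into a_j + a_(j -
   1). *)
pose a j := (if (j <= k)%N then 'C(u, j) * 'C(u.+1 + k - j, k - j) else 0)%N.
have -> : ((1 - x *: 'X) ^+ u * geo N 1 ^+ u.+2)`_k
    = \sum_(j < k.+1) (- x) ^+ j * (a j)%:R.
  rewrite coefM; apply: eq_bigr => -[j /= jk] _.
  rewrite coef_linX coef_geoX; last by lia.
  rewrite /a -ltnS jk natrM.
  rewrite (_ : (u.+2 + (k - j)).-1 = (u.+1 + k - j)%N); last by lia.
  by ring.
rewrite mulrBl mul1r [X in X - _](_ : _ = \sum_(j < k.+2) (- x) ^+ j * (a j)%:R).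
  rewrite [LHS]big_ord_recl [X in X - _]big_ord_recl -addrA; congr (_ + _).
    by rewrite /a leq0n !bin0 !mul1n !subn0.
  rewrite mulr_sumr -sumrB; apply: eq_bigr => -[j /= jk] _; rewrite /bump /= add1n.
  rewrite exprS [RHS](_ : _ = - x * (- x) ^+ j * (a j.+1 + a j)%:R); last first.
    by rewrite natrD; ring.
  congr (_ * _%:R); rewrite /a -(ltnS j) jk.
  have [uj|ju] := ltnP u j.
    rewrite !(bin_small uj) (bin_small (leqW uj)) !mul0n if_same.
    by rewrite [X in (_ * X)%N]bin_small ?muln0 //; lia.
  have := bin_split j (k - j) (u - j).
  rewrite (_ : (j + (k - j) + 1 = k.+1)%N); last by lia.
  rewrite (_ : (u - j + j + (k - j) = u.+1 + k - j.+1)%N); last by lia.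
  rewrite (_ : (j + (k - j) = k)%N); last by lia.
  rewrite (_ : (j + (u - j) = u)%N); last by lia.
  rewrite (_ : (u + 1 + (k - j) = u.+1 + k - j)%N); last by lia.
  move=> ->; congr (_ + _)%N.
  case: ltnP => [ltjk|lekj]; last by have -> : (k - j = 0)%N by lia.
  by have -> : (k - j = (k - j.+1).+1)%N by lia.
by rewrite [RHS]big_ord_recr /= {3}/a ltnn mulr0 addr0.
Qed.

Lemma sum_ord_trunc (F : nat -> A) a b :
  (forall j, (a <= j)%N -> F j = 0) -> (forall j, (b <= j)%N -> F j = 0) ->
  \sum_(j < a) F j = \sum_(j < b) F j.
Proof.
wlog ab : a b / (a <= b)%N => [hw Fa Fb|Fa _].
  by have [/hw|/ltnW/hw] := leqP a b; [apply | move=> e; apply/esym/e].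
rewrite -(subnKC ab) big_split_ord /= [X in _ + X]big1 ?addr0 // => j _.
by apply: Fa; rewrite leq_addr.
Qed.

(** Inclusion-exclusion over the coordinates exceeding [t]: (1 + ... + Y^t)^h is (1 - Y^(t + 1))^h /
    (1 - Y)^h. *)
Lemma coef_box h t k : (geo t.+1 1 ^+ h)`_k = \sum_(j < h.+1)
  (if (k < j * t.+1)%N then 0 else (-1) ^+ j * 'C(h, j)%:R *
     'C((h + (k - j * t.+1)).-1, k - j * t.+1)%:R) :> A.
Proof.
have e : geo t.+1 1 ^+ h * (1 - 'X^(k.+1)) ^+ h
    = (1 - 'X^(t.+1)) ^+ h * geo k.+1 1 ^+ h :> {poly A}.
  rewrite -!exprMn; congr (_ ^+ h).
  have := geoE k.+1 (1 : A); rewrite expr1n !scale1r => <-.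
  have := geoE t.+1 (1 : A); rewrite expr1n !scale1r => <-.
  by ring.
have -> : (geo t.+1 1 ^+ h)`_k = (geo t.+1 1 ^+ h * (1 - 'X^(k.+1)) ^+ h)`_k :> A.
  have H : eqX k.+1 (1 - 'X^(k.+1) : {poly A}) 1.
    by move=> i ik; rewrite coefB coefXn (ltn_eqF ik) subr0.
  have := eqXM (@eqX_refl _ k.+1 (geo t.+1 1 ^+ h)) (eqXX h H).
  by move=> /(_ k (ltnSn k)) ->; rewrite expr1n mulr1.
rewrite e exprBn mulr_suml coef_sum; apply: eq_bigr => -[j /= _] _.
rewrite (_ : _ * _ = ((-1) ^+ j * 'C(h, j)%:R)%:P *
    ('X^(j * t.+1) * geo k.+1 1 ^+ h)).
  rewrite coefCM coefXnM; case: ltnP => kj; first by rewrite mulr0.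
  by rewrite coef_geoX //; lia.
rewrite expr1n mulr1 -exprM (mulnC t.+1) -[_ *+ 'C(h, j)]mulr_natr.
by rewrite polyCM polyC_exp polyCN polyC1 polyC_natr; ring.
Qed.

Lemma coef_box_sub k t r s : (s <= t)%N ->
  (geo t.+2 1 ^+ k.+1)`_(r.+1 * t.+1 - s) = \sum_(j < r.+1)
    (-1) ^+ j * ('C(k.+1, j) * 'C((r.+1 - j) * t.+1 - s + k - j, k))%:R :> A.
Proof.
move=> st; rewrite coef_box.
pose F j : A := if (r.+1 * t.+1 - s < j * t.+2)%N then 0 else
  (-1) ^+ j * 'C(k.+1, j)%:R *
  'C((k.+1 + (r.+1 * t.+1 - s - j * t.+2)).-1, r.+1 * t.+1 - s - j * t.+2)%:R.
rewrite -[LHS]/(\sum_(j < k.+2) F j) (@sum_ord_trunc F k.+2 r.+1).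
- apply: eq_bigr => -[j /= jr] _; rewrite /F natrM -mulrA.
  have [kj|jk] := ltnP k.+1 j.
    by rewrite bin_small // !mul0r !mulr0 if_same.
  have e : (r.+1 * t.+1 = (r.+1 - j) * t.+1 + j * t.+1)%N.
    by rewrite -mulnDl subnK // ltnW.
  (* With [s <= t] this makes [V - s] positive, so [V - s + k - j] is a true difference for
     [j <= k.+1]. *)
  have e1 : (t.+1 <= (r.+1 - j) * t.+1)%N by rewrite leq_pmull // subn_gt0.
  rewrite e [(j * t.+2)%N]mulnS; set V := ((r.+1 - j) * t.+1)%N in e1 *.
  set W := (j * t.+1)%N.
  case: ltnP => lt1; first by rewrite (@bin_small (V - s + k - j)) ?mulr0 //; lia.
  rewrite (_ : (V + W - s - (j + W) = V - s - j)%N); last by lia.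
  rewrite (_ : (k.+1 + (V - s - j)).-1 = (V - s + k - j)%N); last by lia.
  rewrite -(@bin_sub _ (V - s - j)); last by lia.
  by congr (_ * (_ * ('C(_, _))%:R)); lia.
- by move=> j kj; rewrite /F bin_small // mulr0 mul0r if_same.
move=> j rj; rewrite /F ifT //.
have : (r.+1 * t.+1 <= j * t.+1)%N by rewrite leq_mul2r rj orbT.
by rewrite (mulnS j); lia.
Qed.
End BoxCount.

Lemma coef_weighted_split (B : comNzRingType) (x w : B) N n t k : (k <= N)%N ->
  (rat_series x w N n t.+1
     * (geo N.+1 (w + x * (1 - w)) * geo N.+1 1))`_k =
  \sum_(s < t.+1) 'C(t, s)%:R * (w ^+ s * (1 - w) ^+ (t - s)) *
    ((1 - x *: 'X) ^+ (n + t - s) * geo N.+1 1 ^+ (n + t - s).+2)`_k.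
Proof.
move=> kN; set c := w + _.
set X := 1 - x *: 'X; set Y := 1 - 1 *: 'X : {poly B}; set Z := 1 - c *: 'X.
(* The binomial expansion of this splits the sum according to [s]. *)
have ZE : Z = (1 - w)%:P * X + w%:P * Y.
  rewrite /Z /X /Y /c -!mul_polyC !(polyCD, polyCM, polyCN, polyC1); ring.
have XG : eqX N.+1 (Z * geo N.+1 c) 1 by apply: eqX_geo.
have YG : eqX N.+1 (Y * geo N.+1 1) 1 by apply: eqX_geo.
pose W := X ^+ n * geo N.+1 1 ^+ (n + t.+1).+1.
have -> : (rat_series x w N n t.+1 * (geo N.+1 c * geo N.+1 1))`_k
    = (W * Z ^+ t)`_k.
  (* Writing 1 as Z / Z restores the power t + 1 of [Z] that occurs in [rat_series]. *)
  rewrite -[in RHS](mulr1 (W * _)).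
  rewrite -(eqXM (@eqX_refl _ _ (W * Z ^+ t)) XG kN); congr ((polyseq _)`_k).
  by rewrite /rat_series -/c -/Z -/X /W !exprS; ring.
rewrite ZE exprDn mulr_sumr coef_sum; apply: eq_bigr => -[s /= st] _.
set V := _ * geo _ _ ^+ _.
transitivity (('C(t, s)%:R * (w ^+ s * (1 - w) ^+ (t - s)))%:P
  * (V * (Y * geo N.+1 1) ^+ s))`_k; last first.
  rewrite coefCM; congr (_ * _).
  by rewrite (eqXM (@eqX_refl _ _ V) (eqXX s YG) kN) expr1n mulr1.
congr ((polyseq _)`_k).
rewrite /W /V (_ : (n + t.+1).+1 = (n + t - s).+2 + s)%N; last by lia.
rewrite (_ : (n + t - s = n + (t - s))%N); last by lia.
rewrite -[_ *+ 'C(t, s)]mulr_natl !exprMn !exprD !polyCM !polyC_exp polyC_natr; ring.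
Qed.

(** * Box counts with binomial weights as polynomials in the dilation factor *)

Section Assembly.
Variables (A : comNzRingType) (C : A -> Prop) (w : A).
Hypotheses (C0 : C 0) (C1 : C 1).
Hypotheses (CD : forall a b, C a -> C b -> C (a + b)).
Hypotheses (CM : forall a b, C a -> C b -> C (a * b)).
Hypotheses (Cw : C w) (C1w : C (1 - w)).

(** Extracting x^r from the [i]-th summand selects the inclusion-exclusion term [j = r - i];
    reversing the sum over [i] then gives [coef_box_sub]. *)
Lemma binomial_box_positive k r : exists2 P : {poly A}, coneX C P &
  forall t, P.[t.+1%:R] = k`!%:R * \sum_(s < t.+1)
    'C(t, s)%:R * (w ^+ s * (1 - w) ^+ (t - s)) *
    (geo t.+2 1 ^+ k.+1)`_(r.+1 * t.+1 - s).
Proof.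
have C1X : coneX C 1 by rewrite -polyC1; apply: coneXC.
(* Taking [p = q = 0] and [kappa = 1] leaves a single factor [1 - x], which [sum_bin_linX]
   absorbs. *)
have [P CP PE] := positive_sum_weighted C0 C1 CD CM Cw C1w (leqnn k) r 0 0 C1X.
exists P => // t; rewrite {}PE mul1r.
pose c (i j : nat) s : nat := 'C(k.+1, j) * 'C(i.+1 * t.+1 - s + k - j, k).
pose a s : A := 'C(t, s)%:R * (w ^+ s * (1 - w) ^+ (t - s)).
transitivity (\sum_(i < r.+1) ('X^i * (k`!%:R * \sum_(s < t.+1) (a s)%:P *
    \sum_(j < k.+2) (- 'X) ^+ j * (c i j s)%:R))`_r).
  rewrite -coef_sum; congr ((polyseq _)`_r); apply: eq_bigr => i _; congr (_ * _).
  rewrite coef_weighted_split // expr1 !expn0 !muln1 mulr1 mulrCA; congr (_ * _).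
  rewrite mulr_sumr; apply: eq_bigr => -[s /= st] _; rewrite mulrCA.
  have -> : (a s)%:P = 'C(t, s)%:R * (w%:P ^+ s * (1 - w%:P) ^+ (t - s)).
    by rewrite /a !polyCM !polyC_exp polyCB polyC1 polyC_natr.
  congr (_ * _); rewrite -sum_bin_linX //; apply: eq_bigr => j _.
  by congr (_ * _%:R); rewrite /c; congr (_ * 'C(_, _))%N; lia.
transitivity (k`!%:R * \sum_(s < t.+1) a s * \sum_(i < r.+1)
   (-1) ^+ (r - i) * (c i (r - i)%N s)%:R).
  rewrite (eq_bigr (fun i : 'I_r.+1 => k`!%:R * \sum_(s < t.+1) a s *
    ((-1) ^+ (r - i) * (c i (r - i)%N s)%:R))); last first.
    move=> -[i /= ir] _; rewrite coefXnM ltnNge -ltnS ir /=.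
    rewrite -polyC_natr coefCM coef_sum; congr (_ * _); apply: eq_bigr => s _.
    rewrite coefCM coef_sum; congr (_ * _).
    set m := (r - i)%N.
    have coefm j : ((- 'X) ^+ j * (c i j s)%:R)`_m =
        ((-1) ^+ j * (c i j s)%:R) *+ (j == m) :> A.
      have -> : (- 'X) ^+ j * (c i j s)%:R =
          ((-1) ^+ j * (c i j s)%:R)%:P * 'X^j :> {poly A}.
        by rewrite (exprNn 'X) polyCM polyC_exp polyCN polyC1 polyC_natr mulrAC.
      rewrite coefCM coefXn eq_sym.
      by case: eqP => _; rewrite ?mulr1 ?mulr0.
    (* If [r - i] exceeds [k.+1], no index [j] matches and ['C(k.+1, r - i)] vanishes as well. *)
    have [mk|km] := ltnP m k.+2; last first.
      rewrite (_ : c i m s = 0%N) ?mulr0; last by rewrite /c bin_small.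
      rewrite big1 // => j _; rewrite coefm.
      by rewrite (ltn_eqF (leq_trans (ltn_ord j) km)).
    rewrite (bigD1 (Ordinal mk)) //= coefm eqxx mulr1n big1 ?addr0 // => j.
    by rewrite coefm -val_eqE /= => /negPf ->.
  rewrite -mulr_sumr exchange_big /=; congr (_ * _).
  by apply: eq_bigr => s _; rewrite mulr_sumr.
congr (_ * _); apply: eq_bigr => -[s /= st] _; rewrite -/(a s); congr (_ * _).
rewrite coef_box_sub // (reindex_inj rev_ord_inj) /=.
apply: eq_bigr => -[j /= jr] _; rewrite subSS subKn // /c.
by rewrite subSn.
Qed.
End Assembly.

(** * Beta integrals of binomial weights *)

Lemma map_geo (A B : comNzRingType) (f : {rmorphism A -> B}) N a :
  map_poly f (geo N a) = geo N (f a).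
Proof.
apply/polyP => k; rewrite coef_map !coef_poly.
by case: ifP => _; [exact: (rmorphXn f) | exact: (rmorph0 f)].
Qed.

(** These coefficients are constants in [w], so they can be pulled out of the integral over [w]. *)
Lemma coef_geoX_polyC (A : comNzRingType) N n k :
  (geo N 1 ^+ n)`_k = ((geo N 1 ^+ n)`_k)%:P :> {poly A}.
Proof.
rewrite -[X in geo _ X](rmorph1 (polyC : {rmorphism A -> {poly A}})) -map_geo.
by rewrite -rmorphXn coef_map.
Qed.

Section Beta.
Variable R : realFieldType.
Implicit Types p q : {poly R}.

(** A cone given by generators: it is closed under products, and positivity of the integral is read
    off term by term from [beta_integralE]. *)
Inductive bernstein : {poly R} -> Prop :=
| bernstein0 : bernstein 0
| bernstein_cons c a l p : 0 <= c -> bernstein p ->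
    bernstein (c *: ('X^a * (1 - 'X) ^+ l) + p).

Lemma bernstein_monomial c a l : 0 <= c -> bernstein (c *: ('X^a * (1 - 'X) ^+ l)).
Proof. by move=> c0; rewrite -[_ *: _]addr0; apply/bernstein_cons/bernstein0. Qed.

Lemma bernstein1 : bernstein 1.
Proof.
by have := @bernstein_monomial 1 0 0 ler01; rewrite !expr0 mulr1 scale1r.
Qed.

Lemma bernsteinX : bernstein 'X.
Proof.
by have := @bernstein_monomial 1 1 0 ler01; rewrite scale1r expr0 mulr1 expr1.
Qed.

Lemma bernstein1X : bernstein (1 - 'X).
Proof.
by have := @bernstein_monomial 1 0 1 ler01; rewrite scale1r expr0 mul1r expr1.
Qed.

Lemma bernsteinD p q : bernstein p -> bernstein q -> bernstein (p + q).
Proof.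
move=> + Bq; elim=> [|c a l s c0 _ IHs]; first by rewrite add0r.
by rewrite -addrA; apply: bernstein_cons.
Qed.

Lemma bernsteinM p q : bernstein p -> bernstein q -> bernstein (p * q).
Proof.
move=> + Bq; elim=> [|c a l s c0 _ IHs]; first by rewrite mul0r; apply: bernstein0.
rewrite mulrDl; apply: bernsteinD IHs.
elim: Bq => [|d b j u d0 _ IHu]; first by rewrite mulr0; apply: bernstein0.
rewrite mulrDr; apply: bernsteinD IHu.
rewrite (_ : _ * _ = (c * d) *: ('X^(a + b) * (1 - 'X) ^+ (l + j))).
  by apply/bernstein_monomial/mulr_ge0.
by rewrite -!mul_polyC polyCM !exprD; ring.
Qed.

(* The integral of [w ^ m * p w] for [w] from [0] to [1]. *)
Definition beta_integral m p : R := \sum_(i < size p) p`_i / (m + i).+1%:R.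

Lemma beta_integral_widen m p N : (size p <= N)%N ->
  beta_integral m p = \sum_(i < N) p`_i / (m + i).+1%:R.
Proof.
move=> pN; rewrite /beta_integral -(subnKC pN) big_split_ord /=.
rewrite [X in _ + X]big1 ?addr0 // => i _.
by rewrite nth_default ?mul0r // leq_addr.
Qed.

Lemma beta_integralD m : {morph beta_integral m : p q / p + q}.
Proof.
move=> p q; pose N := maxn (size p) (size q).
rewrite !(@beta_integral_widen _ _ N) ?leq_maxl ?leq_maxr ?size_polyD //.
by rewrite -big_split; apply: eq_bigr => i _; rewrite coefD mulrDl.
Qed.

Lemma beta_integralZ m c p : beta_integral m (c *: p) = c * beta_integral m p.
Proof.
rewrite (@beta_integral_widen _ _ (size p)) ?size_scale_leq // mulr_sumr.
by apply: eq_bigr => i _; rewrite coefZ mulrA.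
Qed.

Lemma beta_integral0 m : beta_integral m 0 = 0.
Proof. by rewrite -(scale0r 0) beta_integralZ mul0r. Qed.

Lemma beta_integral_sum m (I : Type) (s : seq I) (F : I -> {poly R}) :
  beta_integral m (\sum_(i <- s) F i) = \sum_(i <- s) beta_integral m (F i).
Proof. exact: (big_morph _ (beta_integralD m) (beta_integral0 m)). Qed.

Lemma beta_integralXn m a : beta_integral m 'X^a = (m + a).+1%:R^-1.
Proof.
rewrite (@beta_integral_widen _ _ a.+1) ?size_polyXn // big_ord_recr /= big1.
  by rewrite add0r coefXn eqxx mul1r.
by move=> i _; rewrite coefXn ltn_eqF ?mul0r.
Qed.

(** The beta value B(m + a + 1, l + 1), by induction from (1 - w)^(l + 1) = (1 - w)^l - w (1 -
    w)^l. *)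
Lemma beta_integralE m a l : beta_integral m ('X^a * (1 - 'X) ^+ l) =
  ((m + a)`! * l`!)%:R / (m + a + l).+1`!%:R.
Proof.
elim: l a => [|l IHl] a.
  rewrite expr0 mulr1 beta_integralXn addn0 fact0 muln1 factS natrM.
  by rewrite invfM mulrCA mulfV ?mulr1 // pnatr_eq0 -lt0n fact_gt0.
have -> : 'X^a * (1 - 'X) ^+ l.+1
    = 'X^a * (1 - 'X) ^+ l + (-1) *: ('X^(a.+1) * (1 - 'X) ^+ l) :> {poly R}.
  by rewrite scaleN1r !exprS; ring.
rewrite beta_integralD beta_integralZ !IHl !addnS !addSn.
have F0 : (m + a + l).+1`!%:R != 0 :> R by rewrite pnatr_eq0 -lt0n fact_gt0.
have n0 : (m + a + l).+2%:R != 0 :> R by rewrite pnatr_eq0.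
rewrite (factS (m + a + l).+1) (factS (m + a)) (factS l).
move: (m + a + l).+1`! F0 => F F0; rewrite !natrM.
by move: n0; rewrite -!natr1 !natrD => n0; field; rewrite F0.
Qed.

Lemma beta_integral_ge0 m p : bernstein p -> 0 <= beta_integral m p.
Proof.
elim=> [|c a l q c0 _ IHq]; first by rewrite beta_integral0.
rewrite beta_integralD beta_integralZ beta_integralE addr_ge0 //.
by rewrite mulr_ge0 // divr_ge0 // ler0n.
Qed.

(** The prefactor is independent of [s] and is a rising factorial in t + 1, with nonnegative
    coefficients; so passing from binomial weights to ['C(s + m, m)] preserves positivity. *)
Lemma beta_binomial m t s : (s <= t)%N ->
  m`!%:R^-1 * (\prod_(i < m.+1) (t.+1 + i)%:R) *
    beta_integral m ('C(t, s)%:R *: ('X^s * (1 - 'X) ^+ (t - s)))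
  = 'C(s + m, m)%:R.
Proof.
move=> st; rewrite beta_integralZ beta_integralE.
have prodE : (\prod_(i < m.+1) (t.+1 + i)%:R) * t`!%:R = (m + t).+1`!%:R :> R.
  elim: m => [|m IHm]; first by rewrite big_ord1 addn0 factS natrM.
  rewrite big_ord_recr /= mulrAC IHm mulrC -natrM (addSn m) factS.
  by congr (_ * _)%:R; lia.
have F0 n : n`!%:R != 0 :> R by rewrite pnatr_eq0 -lt0n fact_gt0.
have -> : (m + s + (t - s) = m + t)%N by lia.
have p0 : \prod_(i < m.+1) (t.+1 + i)%:R != 0 :> R.
  by apply/prodf_neq0 => i _; rewrite pnatr_eq0.
have C0 : 'C(t, s)%:R != 0 :> R by rewrite pnatr_eq0 -lt0n bin_gt0.
have sm : 'C(s + m, m)%:R * (m`!%:R * s`!%:R) = (m + s)`!%:R :> R.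
  have := @bin_fact (s + m) m (leq_addl s m); rewrite addnK => sm.
  by rewrite -!natrM sm addnC.
rewrite -prodE -(bin_fact st) !natrM -sm.
by field; rewrite C0 p0 !F0.
Qed.
End Beta.

Lemma coneX_prod_natD (R : realFieldType) m k :
  0 <= (\prod_(i < m) ('X + i%:R%:P) : {poly R})`_k.
Proof.
elim: m k => [|m IHm] k; first by rewrite big_ord0 coef1 ler0n.
rewrite big_ord_recr /= mulrDr coefD mulrC coefXM coefMC.
by rewrite addr_ge0 ?mulr_ge0 ?ler0n //; case: ifP.
Qed.

(** [Q] is a rising factorial times the coefficientwise integral over [w] of the polynomial for
    binomial weights. In the application [k + 1], [m + 1] and [r + 1] are |H|, n - |H| and the
    rank. *)
Lemma simplex_box_positive (R : realFieldType) m k r :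
  exists2 Q : {poly R}, forall i, 0 <= Q`_i & forall t : nat, Q.[t%:R] =
    \sum_(s < t) 'C(s + m, m)%:R * (geo t.+1 1 ^+ k.+1)`_(r.+1 * t - s).
Proof.
have [P CP PE] := @binomial_box_positive {poly R} (@bernstein R) 'X
  (bernstein0 R) (bernstein1 R) (@bernsteinD R) (@bernsteinM R)
  (bernsteinX R) (bernstein1X R)
  k r.
exists ((k`!%:R^-1 * m`!%:R^-1) *: (\prod_(i < m.+1) ('X + i%:R%:P) *
  \poly_(i < size P) beta_integral m P`_i)).
  move=> i; rewrite coefZ mulr_ge0 ?mulr_ge0 ?invr_ge0 ?ler0n // coefM.
  apply: sumr_ge0 => j _; rewrite mulr_ge0 ?coneX_prod_natD // coef_poly.
  by case: ifP => // _; apply/beta_integral_ge0/CP.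
have prodE (t : nat) : (\prod_(i < m.+1) ('X + i%:R%:P)).[t%:R]
    = \prod_(i < m.+1) (t + i)%:R :> R.
  rewrite horner_prod; apply: eq_bigr => i _.
  by rewrite hornerD hornerX hornerC natrD.
case=> [|t]; rewrite hornerZ hornerM prodE.
  (* At [t = 0] the sum is empty, and the first factor of the rising factorial vanishes. *)
  by rewrite big_ord0 big_ord_recl mul0r mul0r mulr0.
have -> : (\poly_(i < size P) beta_integral m P`_i).[t.+1%:R]
    = beta_integral m P.[t.+1%:R].
  rewrite horner_poly horner_coef beta_integral_sum; apply: eq_bigr => i _.
  by rewrite mulrC -beta_integralZ -mul_polyC polyC_exp polyC_natr mulrC.
rewrite PE -polyC_natr mul_polyC beta_integralZ beta_integral_sum.
have k0 : k`!%:R != 0 :> R by rewrite pnatr_eq0 -lt0n fact_gt0.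
have m0 : m`!%:R != 0 :> R by rewrite pnatr_eq0 -lt0n fact_gt0.
set S := \sum_(s < _) beta_integral _ _; set Pi := \prod_(i < _) _.
transitivity (m`!%:R^-1 * Pi * S); first by field; rewrite k0 m0.
rewrite mulr_sumr; apply: eq_bigr => -[s /= st] _.
rewrite -(@beta_binomial R m t s st).
rewrite coef_geoX_polyC.
rewrite [_ * _%:P]mulrC mul_polyC beta_integralZ -polyC_natr mul_polyC /Pi; ring.
Qed.

(** * Lattice points of the slice, counted by generating functions *)

Section Counting.
Variables (R : realFieldType) (n : nat) (H : {set 'I_n}).

(** Coordinates in [H] contribute powers of the outer variable and the others powers of the inner
    one; expanding the product over all coordinates enumerates the functions [f]. *)
Lemma count_box_split T a b :
  #|[set f : {ffun 'I_n -> 'I_T} |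
      (\sum_(i in H) f i == a)%N && (\sum_(i in ~: H) f i == b)%N]|%:R
  = (geo T 1 ^+ #|H|)`_a * (geo T 1 ^+ #|~: H|)`_b :> R.
Proof.
pose F (i : 'I_n) (j : 'I_T) : {poly {poly R}} :=
  if i \in H then 'X^j else ('X^j)%:P.
have FE (f : {ffun 'I_n -> 'I_T}) : \prod_i F i (f i)
    = 'X^(\sum_(i in H) f i) * ('X^(\sum_(i in ~: H) f i))%:P.
  rewrite (bigID (mem H)) /=; congr (_ * _).
    by rewrite -prodrXr; apply: eq_bigr => i iH; rewrite /F iH.
  rewrite -prodrXr rmorph_prod; apply: eq_big => i; first by rewrite inE.
  by rewrite /F => /negPf ->.
have prodF : \prod_i \sum_j F i j
    = geo T 1 ^+ #|H| * (geo T 1 ^+ #|~: H|)%:P.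
  rewrite (bigID (mem H)) /=; congr (_ * _).
    rewrite -prodr_const; apply: eq_bigr => i iH; rewrite /geo poly_def.
    by apply: eq_bigr => j _; rewrite /F iH expr1n scale1r.
  rewrite -prodr_const rmorph_prod; apply: eq_big => i; first by rewrite inE.
  move=> /negPf iH; rewrite /geo poly_def rmorph_sum.
  by apply: eq_bigr => j _; rewrite /F iH expr1n scale1r.
transitivity (\prod_i \sum_j F i j)`_a`_b; last first.
  by rewrite prodF coefMC coef_geoX_polyC coefCM.
rewrite bigA_distr_bigA coef_sum coef_sum -sum1_card natr_sum.
rewrite big_mkcond; apply: eq_bigr => f _.
rewrite FE coefMC coefXn inE mulr_natl coefMn coefXn eq_sym [b == _]eq_sym.
by case: eqP => _; case: eqP.
Qed.

(** Let [s] be the sum over the complement of [H]: the slice condition becomes [s < t], and the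
    coordinates outside [H] range over a full dilated simplex with ['C(s + m, m)] lattice points. *)
Lemma count_box_slab m k r t : #|H| = k.+1 -> #|~: H| = m.+1 ->
  #|[set f : {ffun 'I_n -> 'I_t.+1} |
      (\sum_i f i == r.+1 * t)%N && (r * t < \sum_(i in H) f i)%N]|%:R
  = \sum_(s < t) 'C(s + m, m)%:R * (geo t.+1 1 ^+ k.+1)`_(r.+1 * t - s) :> R.
Proof.
move=> cH cHc.
transitivity (\sum_(s < t) #|[set f : {ffun 'I_n -> 'I_t.+1} |
   (\sum_(i in H) f i == r.+1 * t - s)%N && (\sum_(i in ~: H) f i == s)%N]|%:R : R).
  rewrite -natr_sum; congr (_%:R); rewrite -sum1_card.
  under [RHS]eq_bigr => s _ do rewrite -sum1_card big_mkcond.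
  rewrite exchange_big big_mkcond /=; apply: eq_bigr => f _.
  have sE : (\sum_i f i = \sum_(i in H) f i + \sum_(i in ~: H) f i)%N.
    by rewrite (bigID (mem H)) /=; congr (_ + _)%N; apply: eq_bigl => i; rewrite inE.
  rewrite inE sE; under [RHS]eq_bigr => s _ do rewrite inE.
  move: (\sum_(i in H) f i)%N (\sum_(i in ~: H) f i)%N => x y.
  have rt : (r.+1 * t = r * t + t)%N by rewrite mulSn addnC.
  case: ifP => [/andP[/eqP xy lt]|].
    have yt : (y < t)%N by lia.
    rewrite (bigD1 (Ordinal yt)) //= big1 => [|s /eqP sy].
      by rewrite ifT //; apply/andP; split; apply/eqP; lia.
    case: eqP => //= _; case: eqP => //= ys.
    by case: sy; apply/val_inj.
  move=> /negP nxy; rewrite big1 // => -[s /= st] _.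
  case: eqP => //= xE; case: eqP => //= yE.
  by case: nxy; apply/andP; split; first (apply/eqP); lia.
apply: eq_bigr => s _; rewrite count_box_split cH cHc mulrC; congr (_ * _).
rewrite coef_geoX; last exact: leqW.
by rewrite addSn /= -(@bin_sub (m + s)) ?leq_addl // addnK addnC.
Qed.
End Counting.

(** * Base polytopes *)

Local Open Scope classical_set_scope.
Local Open Scope card_scope.
Local Open Scope ring_scope.

Lemma card_eq_setU (T : choiceType) (A B : set T) a b :
  A `&` B = set0 -> A #= `I_a -> B #= `I_b -> (A `|` B) #= `I_(a + b).
Proof.
move=> AB Aa Bb.
have /finite_fsetP[X XE] : finite_set A by apply/finite_setP; exists a.
have /finite_fsetP[Y YE] : finite_set B by apply/finite_setP; exists b.
move: Aa Bb; rewrite XE YE -set_fsetU => /card_eq_fsetP Xa /card_eq_fsetP Yb.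
apply/card_eq_fsetP; rewrite cardfsU Xa Yb.
suff -> : (X `&` Y)%fset = fset0 by rewrite cardfs0 subn0.
apply/eqP/fset0Pn => -[x]; rewrite in_fsetI => /andP[xX xY].
have : (A `&` B) x by rewrite XE YE; split.
by rewrite AB.
Qed.

Lemma card_eq_image_finset (T : choiceType) (I : finType) (f : I -> T) (D : {set I}) :
  injective f -> [set f i | i in [set` D]] #= `I_#|D|.
Proof.
move=> finj.
have -> : [set f i | i in [set` D]] = [set` [fset f i | i in D]%fset].
  apply/seteqP; split => [_ [i iD <-]|x /imfsetP[i iD ->]]; last by exists i.
  by apply/imfsetP; exists i.
by apply/card_eq_fsetP; rewrite card_imfset //= cardE.
Qed.

Section Convex.
Variables (R : realType) (d : nat).
Implicit Types (K : set 'rV[R]_d) (x y : 'rV[R]_d).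

Lemma convex_setE K : @convex_set R 'rV[R]_d K <->
  forall x y l, 0 <= l <= 1 -> K x -> K y -> K (l *: x + (1 - l) *: y).
Proof.
split=> [cK x y l /andP[l0 l1] Kx Ky|cK x y l].
  by have := cK x y (Itv01 l0 l1); rewrite !inE; apply.
rewrite !inE => Kx Ky; apply: (cK x y l%:num) => //.
by rewrite ge0 le1.
Qed.

Lemma convex_hull_convex K : @convex_set R 'rV[R]_d (convex_hull K).
Proof.
apply/convex_setE => x y l l01 Kx Ky L [cL KL].
by apply: (iffLR (convex_setE L)) => //; [apply: Kx | apply: Ky].
Qed.

End Convex.

(** * Integrality of slabs of the hypersimplex *)

Section Slab.
Variables (R : realType) (n : nat).
Implicit Types (v : 'rV[R]_n) (i j l : 'I_n) (H B : {set 'I_n}).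

Definition slab H r lo hi v := [/\ forall i, 0 <= v 0 i <= 1,
  \sum_i v 0 i = r%:R & lo%:R <= \sum_(i in H) v 0 i <= hi%:R].

Definition fractional v : {set 'I_n} := [set i | (v 0 i != 0) && (v 0 i != 1)]%SET.

(* Moves as much weight from [i] to [j] as the unit cube allows, which makes one
   of the two coordinates integral. *)
Definition transfer v i j : 'rV[R]_n :=
  v - Num.min (v 0 i) (1 - v 0 j) *: (delta_mx 0 i - delta_mx 0 j).

Lemma sum_transfer (P : pred 'I_n) v i j :
  \sum_(l | P l) transfer v i j 0 l = \sum_(l | P l) v 0 l
    - Num.min (v 0 i) (1 - v 0 j) * ((P i)%:R - (P j)%:R).
Proof.
have sum_delta k : \sum_(l | P l) (delta_mx 0 k : 'rV[R]_n) 0 l = (P k)%:R.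
  rewrite (eq_bigr (fun l => (l == k)%:R)) => [|l _]; last by rewrite mxE eqxx.
  case Pk: (P k).
    rewrite (bigD1 k) //= eqxx big1 ?addr0 // => l /andP[_ /negPf -> //].
  by rewrite big1 // => l Pl; case: eqP => // lk; rewrite lk Pk in Pl.
rewrite -!sum_delta -sumrB mulr_sumr -sumrB.
by apply: eq_bigr => l _; rewrite !mxE.
Qed.

Lemma fractional_itv v i : 0 <= v 0 i <= 1 -> i \in fractional v -> 0 < v 0 i < 1.
Proof.
by rewrite inE => /andP[v0 v1] /andP[n0 n1]; rewrite !lt_neqAle v0 v1 eq_sym n0 n1.
Qed.

Lemma transferE v i j l : transfer v i j 0 l =
  v 0 l - Num.min (v 0 i) (1 - v 0 j) * ((l == i)%:R - (l == j)%:R).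
Proof. by rewrite !mxE !eqxx. Qed.

Lemma transfer_itv v i j : i != j -> (forall l, 0 <= v 0 l <= 1) ->
  forall l, 0 <= transfer v i j 0 l <= 1.
Proof.
move=> ij v01 l; rewrite transferE.
have := v01 i; have := v01 j; have := v01 l.
have [li|li] := eqVneq l i; have [lj|lj] := eqVneq l j.
- by rewrite -li lj eqxx in ij.
- by rewrite subr0 mulr1 li; case: (leP (v 0 i) (1 - v 0 j)); lra.
- by rewrite sub0r mulrN1 lj; case: (leP (v 0 i) (1 - v 0 j)); lra.
by rewrite subrr mulr0 subr0.
Qed.

Lemma fractional_transfer v i j : i != j -> i \in fractional v ->
  j \in fractional v -> (#|fractional (transfer v i j)| < #|fractional v|)%N.
Proof.
move=> ij vi vj; apply: proper_card; apply/properP; split.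
  apply/fintype.subsetP => l; have [->//|li] := eqVneq l i.
  have [->//|lj] := eqVneq l j.
  by rewrite !inE !transferE (negPf li) (negPf lj) subrr mulr0 subr0.
have [m1|m2] := leP (v 0 i) (1 - v 0 j).
  exists i => //; rewrite inE transferE eqxx (negPf ij) (min_idPl m1).
  by rewrite subr0 mulr1 subrr eqxx.
exists j => //; rewrite inE transferE eqxx [j == i]eq_sym (negPf ij) (min_idPr (ltW m2)).
by rewrite sub0r mulrN1 opprK addrC subrK eqxx andbF.
Qed.

(** The transfers displace [v] by [a] and [b] in opposite directions along one line, so the weights
    b / (a + b) and a / (a + b) recover [v]. *)
Lemma convex_transfer (K : set 'rV[R]_n) v i j : @convex_set R 'rV[R]_n K ->
  0 < v 0 i < 1 -> 0 < v 0 j < 1 ->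
  K (transfer v i j) -> K (transfer v j i) -> K v.
Proof.
move=> /convex_setE cK vi vj Kij Kji.
pose a := Num.min (v 0 i) (1 - v 0 j); pose b := Num.min (v 0 j) (1 - v 0 i).
have a0 : 0 < a by rewrite /a; case: (leP (v 0 i) (1 - v 0 j)); lra.
have b0 : 0 < b by rewrite /b; case: (leP (v 0 j) (1 - v 0 i)); lra.
have ab0 : a + b != 0 by lra.
have -> : v = (b / (a + b)) *: transfer v i j + (1 - b / (a + b)) *: transfer v j i.
  apply/rowP => l; rewrite !mxE -/a -/b.
  set e := _%:R; set f := _%:R; field; lra.
apply: cK => //; rewrite divr_ge0 /= ?ler_pdivrMr; lra.
Qed.

Lemma sum_fractional (P : pred 'I_n) v :
  exists N : nat, \sum_(l | P l) v 0 l =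
    N%:R + \sum_(l | P l && (l \in fractional v)) v 0 l.
Proof.
exists #|[set l | P l && (v 0 l == 1)]%SET|.
rewrite (bigID (mem (fractional v))) /= addrC; congr (_ + _).
rewrite -sum1_card natr_sum.
rewrite (bigID (fun l => v 0 l == 1)) /= [X in _ + X]big1 ?addr0; last first.
  by move=> l; rewrite inE negb_and !negbK; case: (v 0 l =P 0) => //= _;
    case: (v 0 l == 1); rewrite ?andbF.
apply: eq_big => l; last by move=> /andP[_ /eqP].
rewrite !inE negb_and !negbK; case: (v 0 l == 1) => /=; rewrite ?andbF //.
by rewrite orbT !andbT.
Qed.

Lemma sum_indicator (Q : pred 'I_n) B :
  \sum_(i | Q i) indicator R B 0 i = #|[set i in B | Q i]%SET|%:R.
Proof.
rewrite -sum1_card natr_sum big_mkcond [RHS]big_mkcond /=.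
apply: eq_bigr => l _; rewrite mxE.
have -> : (l \in [set l in B | Q l]%SET) = (l \in B) && Q l by rewrite [LHS]inE.
by case: (l \in B); case: (Q l).
Qed.

Lemma sum_indicatorI H B : \sum_(i in H) indicator R B 0 i = #|B :&: H|%:R.
Proof. by rewrite sum_indicator; congr (#|pred_of_set _|%:R). Qed.

(* Weight is moved between two fractional coordinates on the same side of [H]
   or, if there are none, between the only fractional coordinate on each side: the
   sums over [H] and over its complement then stay between the same integers. *)
Lemma slab_convex_hull (K : set 'rV[R]_n) H r lo hi v :
  @convex_set R 'rV[R]_n K ->
  (forall B, #|B| = r -> (lo <= #|B :&: H| <= hi)%N -> K (indicator R B)) ->
  slab H r lo hi v -> K v.
Proof.
move=> cK KB; have [k] := ubnP #|fractional v|.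
elim: k v => // k IHk v ltk [v01 vr vH].
have frac_itv i := fractional_itv (v01 i).
have step i j : i != j -> i \in fractional v -> j \in fractional v ->
    slab H r lo hi (transfer v i j) -> slab H r lo hi (transfer v j i) -> K v.
  move=> ij vi vj sij sji; apply: (@convex_transfer _ v i j) => //.
  - exact: frac_itv.
  - exact: frac_itv.
  - apply: IHk => //; rewrite -ltnS; apply: leq_trans ltk; rewrite ltnS.
    exact: fractional_transfer.
  apply: IHk => //; rewrite -ltnS; apply: leq_trans ltk; rewrite ltnS.
  by apply: fractional_transfer => //; rewrite eq_sym.
have tsum i j : \sum_l transfer v i j 0 l = r%:R.
  by rewrite sum_transfer subrr mulr0 subr0.
have same i j : i != j -> i \in fractional v -> j \in fractional v ->
    (i \in H) = (j \in H) -> K v.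
  move=> ij vi vj Hij; apply: (step i j) => //; split => //.
  - exact: transfer_itv.
  - by rewrite sum_transfer Hij subrr mulr0 subr0.
  - by apply: transfer_itv; rewrite 1?eq_sym.
  by rewrite sum_transfer Hij subrr mulr0 subr0.
have [f0|[i vi]] := set_0Vmem (fractional v).
  pose B := [set l | v 0 l == 1]%SET.
  have vE l : v 0 l = (l \in B)%:R.
    have : l \notin fractional v by rewrite f0 inE.
    by rewrite !inE negb_and !negbK => /orP[] /eqP ->; rewrite ?eqxx // eq_sym oner_eq0.
  have vB : v = indicator R B by apply/rowP => l; rewrite mxE vE.
  rewrite vB; apply: KB; last by move: vH; rewrite vB sum_indicatorI !ler_nat.
  move: vr; rewrite vB sum_indicator => /eqP; rewrite eqr_nat => /eqP <-.
  by apply: eq_card => l; rewrite [RHS]inE andbT.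
(* A single fractional coordinate would put the integer [r] strictly between consecutive
   integers. *)
have [j /andP[vj ji]|noj] := pickP [pred j in fractional v | j != i]; last first.
  have [N] := sum_fractional predT v.
  rewrite vr (big_pred1 i) => [rN|l].
    have := frac_itv i vi; have : (N%:R < r%:R :> R) && (r%:R < N.+1%:R :> R).
      by rewrite rN -natr1; have := frac_itv i vi; lra.
    by rewrite !ltr_nat => /andP[]; lia.
  have := noj l; rewrite /= andbC; case: eqP => [-> //|] //=.
have [Hij|Hij] := eqVneq (i \in H) (j \in H).
  by apply: (same i j) => //; rewrite eq_sym.
(* Among three fractional coordinates, two lie on the same side of [H]. *)
have [l /and3P[vl li lj]|nol] :=
    pickP [pred l | [&& l \in fractional v, l != i & l != j]].
  have [Hil|Hil] := eqVneq (i \in H) (l \in H).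
    by apply: (same i l) => //; rewrite eq_sym.
  apply: (same j l) => //; first by rewrite eq_sym.
  by move: Hij Hil; do 3!case: (_ \in H).
wlog iH : i j vi vj ji Hij nol / i \in H => [hw|].
  have [iH|iH] := boolP (i \in H); first exact: (hw i j).
  have jH : j \in H by move: Hij; rewrite (negPf iH); case: (j \in H).
  apply: (hw j i) => //; rewrite 1?eq_sym //.
  by move=> l; have := nol l; rewrite /= [(l != i) && _]andbC.
have jH : j \notin H by move: Hij; rewrite iH; case: (j \in H).
have ij : i != j by rewrite eq_sym.
have [N] := sum_fractional predT v.
rewrite vr (bigD1 i) //= (big_pred1 j) => [rN|l]; last first.
  have := nol l; rewrite /=; have [->|lj] := eqVneq l j; first by rewrite vj ji.
  by rewrite andbT; case: (l \in _) => //=; case: (l != i).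
have [N' HN] := sum_fractional (mem H) v.
move: HN; rewrite /= [X in _ = _ + X](big_pred1 i) => [HN|l]; last first.
  have := nol l; rewrite /=; have [->|li] := eqVneq l i; first by rewrite vi iH.
  have [->|lj] := eqVneq l j; first by rewrite (negPf jH).
  by rewrite /= andbT => ->; rewrite andbF.
have vi01 := frac_itv i vi; have vj01 := frac_itv j vj.
(* This sum lies strictly between 0 and 2 and differs from [r] by an integer. *)
have vij : v 0 i + v 0 j = 1.
  have : (N%:R < r%:R :> R) && (r%:R < N.+2%:R :> R).
    by rewrite rN -!natr1; lra.
  rewrite !ltr_nat => /andP[Nr rN2]; have rE : r = N.+1.
    by apply/eqP; rewrite eqn_leq Nr -ltnS rN2.
  by move: rN; rewrite rE -natr1; lra.
(* The sum over [H] is [N'] plus a proper fraction, so the values [N'] and [N' + 1] reached by the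
   two transfers stay within the bounds. *)
have loN : (lo <= N')%N.
  by rewrite -ltnS -(ltr_nat R) -natr1; move: vH; rewrite HN; lra.
have Nhi : (N' < hi)%N.
  by rewrite -(ltr_nat R); move: vH; rewrite HN; lra.
move: loN Nhi; rewrite -!(ler_nat R) -natr1 => loN Nhi.
apply: (step i j) => //; split => //.
- exact: transfer_itv.
- rewrite sum_transfer iH (negPf jH) HN subr0 mulr1.
  by case: (leP (v 0 i) (1 - v 0 j)); lra.
- by apply: transfer_itv.
rewrite sum_transfer iH (negPf jH) HN sub0r mulrN1.
by case: (leP (v 0 j) (1 - v 0 i)); lra.
Qed.

End Slab.

(** * Bases near a stressed hyperplane *)

Section StressedBases.
Variables (n : nat) (M : matroid n) (H : {set 'I_n}).
Hypothesis stressedH : stressed_hyperplane M H.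
Implicit Types (B S : {set 'I_n}).

Lemma hyperplane_rank : (rank_of M H).+1 = mrank M.
Proof. by have /andP[/andP[_ /eqP]] := stressedH. Qed.

Lemma basis_hyperplane_lt B : B \in bases M -> (#|B :&: H| < mrank M)%N.
Proof.
move=> BM; rewrite -hyperplane_rank ltnS finset.setIC.
exact: (leq_bigmax_cond (F := fun B : {set 'I_n} => #|H :&: B|) B).
Qed.

Lemma basis_in_hyperplaneU1 w : w \notin H ->
  exists2 B, B \in bases M & B \subset w |: H.
Proof.
move=> wH; have /andP[/andP[/forallP /(_ w) flatH _] _] := stressedH.
have Mpos : (0 < #|bases M|)%N by rewrite card_gt0 bases_neq0.
have [B BM Bw] := eq_bigmax_cond (fun B : {set 'I_n} => #|(w |: H) :&: B|) Mpos.
exists B => //; apply/finset.setIidPr/eqP; rewrite eqEcard finset.subsetIr /=.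
by rewrite (bases_card BM) -Bw -hyperplane_rank; move: flatH; rewrite wH.
Qed.

(** Adding to [I] an element [e] of [H] gives a circuit of size r, so [I] extends to a basis by an
    element of a basis inside [w |: H]. No basis lies in [H], hence this element is [w]. *)
Lemma stressed_basis S : (mrank M <= #|H|)%N -> #|S| = mrank M ->
  (#|S :&: H|).+1 = mrank M -> S \in bases M.
Proof.
move=> rH cS cSH; pose I := S :&: H.
have [w wS wH] : exists2 w, w \in S & w \notin H.
  by apply/subsetPn; apply/negP => /finset.setIidPl SH; rewrite SH cS in cSH; lia.
have [e eH eI] : exists2 e, e \in H & e \notin I.
  by apply/subsetPn; apply/negP => /subset_leq_card; rewrite -ltnS cSH; lia.
have wI : w \notin I by rewrite inE (negPf wH) andbF.
have cC : #|e |: I| = mrank M by rewrite cardsU1 eI.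
have CH : e |: I \subset H by rewrite finset.subUset finset.sub1set eH finset.subsetIr.
have circC : circuit M (e |: I).
  by have /andP[_ /forallP/(_ (e |: I))] := stressedH; rewrite CH cC eqxx.
have [B BM Bw] := basis_in_hyperplaneU1 wH.
have [y yD yM] := circuit_augment cC circC (finset.setU11 e I) BM.
rewrite finset.setU1K // in yD yM.
have yw : y = w.
  move: yD; rewrite inE => /andP[_ /(fintype.subsetP Bw)].
  rewrite in_setU1 => /orP[/eqP //|yH].
  have := basis_hyperplane_lt yM.
  rewrite (finset.setIidPl _) ?(bases_card yM) ?ltnn //.
  by rewrite finset.subUset finset.sub1set yH finset.subsetIr.
suff -> : S = w |: I by rewrite -yw.
apply/esym/eqP; rewrite eqEcard finset.subUset finset.sub1set wS finset.subsetIl /=.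
by rewrite cardsU1 wI add1n cSH cS.
Qed.

Lemma hyperplane_proper : (0 < #|~: H|)%N.
Proof.
have /set0Pn[B BM] := bases_neq0 M; rewrite card_gt0.
apply: contraTneq (basis_hyperplane_lt BM) => H0.
by rewrite -[H]finset.setCK H0 finset.setC0 finset.setIT (bases_card BM) ltnn.
Qed.

End StressedBases.

Section Polytope.
Variables (R : realType) (n : nat) (M : matroid n).
Local Notation P := (@base_polytope R n M).
Implicit Types (v x y : 'rV[R]_n) (B H : {set 'I_n}).

Lemma sum_conv (Q : pred 'I_n) (l : R) x y :
  \sum_(i | Q i) (l *: x + (1 - l) *: y) 0 i
    = l * \sum_(i | Q i) x 0 i + (1 - l) * \sum_(i | Q i) y 0 i.
Proof.
by rewrite !mulr_sumr -big_split; apply: eq_bigr => i _; rewrite !mxE.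
Qed.

Lemma convex_slab H r lo hi : @convex_set R 'rV[R]_n (slab H r lo hi).
Proof.
apply/convex_setE => x y l /andP[l0 l1] [x01 xr xH] [y01 yr yH]; split.
- by move=> i; rewrite !mxE; have := x01 i; have := y01 i; nra.
- by rewrite sum_conv xr yr; ring.
by rewrite sum_conv; nra.
Qed.

Lemma base_polytope_slab H hi : (forall B, B \in bases M -> (#|B :&: H| <= hi)%N) ->
  P `<=` slab H (mrank M) 0 hi.
Proof.
move=> Bhi; apply: smallest_sub; first exact: convex_slab.
move=> _ [B BM <-]; split.
- by move=> i; rewrite mxE; case: (_ \in _); rewrite ?ler01 ?lexx.
- rewrite sum_indicator -(bases_card BM); congr (#|pred_of_set _|%:R).
  by apply/setP => i; rewrite inE andbT.
by rewrite sum_indicatorI !ler_nat /=; apply: Bhi.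
Qed.

Lemma slab_base_polytope H lo hi :
  (forall B, #|B| = mrank M -> (lo <= #|B :&: H| <= hi)%N -> B \in bases M) ->
  slab H (mrank M) lo hi `<=` P.
Proof.
move=> BM v; apply: slab_convex_hull; first exact: convex_hull_convex.
by move=> B cB BH; apply: sub_gen_smallest; exists B => //; apply: BM.
Qed.

End Polytope.

(** * The base polytope of the relaxation *)

Section Relaxation.
Variables (R : realType) (n : nat) (M : matroid n) (H : {set 'I_n}).
Hypotheses (stressedH : stressed_hyperplane M H) (le_r_H : (mrank M <= #|H|)%N).
Local Notation relM := (relaxation stressedH).
Local Notation P := (@base_polytope R n).
Local Notation q := (rank_of M H).
Implicit Types (x y u v : 'rV[R]_n).

Lemma mrank_relaxation : mrank relM = mrank M.
Proof.
have /set0Pn[B BM] := bases_neq0 M.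
have BN : B \in bases relM by rewrite inE BM.
by rewrite -(bases_card BN) (bases_card BM).
Qed.

Lemma base_polytope_hyperplane x : P M x -> slab H (mrank M) 0 q x.
Proof.
apply: base_polytope_slab => B BM.
by rewrite -ltnS (hyperplane_rank stressedH) (basis_hyperplane_lt stressedH BM).
Qed.

(** This is [P M] together with the slice x(H) > r - 1; the implication form keeps the two cases
    apart in the proof of convexity. *)
Definition relaxed_polytope : set 'rV[R]_n := [set x |
  slab H (mrank M) 0 (mrank M) x /\ (\sum_(i in H) x 0 i <= q%:R -> P M x)].

Lemma face_base_polytope u : slab H (mrank M) q q u -> P M u.
Proof.
apply: slab_base_polytope => B cB; rewrite -eqn_leq => /eqP cBH.
by apply: (stressed_basis stressedH) => //; rewrite -cBH (hyperplane_rank stressedH).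
Qed.

(* The segment from [x] to [y] crosses the face [x(H) = r - 1] of [P M]. *)
Lemma relaxed_polytope_cross x y (l : R) : 0 <= l <= 1 ->
  relaxed_polytope x -> relaxed_polytope y ->
  \sum_(i in H) x 0 i <= q%:R -> q%:R < \sum_(i in H) y 0 i ->
  \sum_(i in H) (l *: x + (1 - l) *: y) 0 i <= q%:R ->
  P M (l *: x + (1 - l) *: y).
Proof.
move=> /andP[l0 l1] [sx Px] [sy _] xq qy; rewrite sum_conv.
move: (sx) (sy) => [_ xr _] [_ yr _].
set a := \sum_(i in H) x 0 i in xq Px *; set b := \sum_(i in H) y 0 i in qy *.
move=> zq; have {}Px := Px xq.
have [aq|aq] := eqVneq a q%:R.
  have -> : l = 1.
    by apply/eqP; rewrite eq_le l1 /=; rewrite aq in zq; nra.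
  by rewrite subrr scale0r addr0 scale1r.
have aq' : a < q%:R by rewrite lt_neqAle aq.
(* Solves s a + (1 - s) b = q, which places the crossing point on the face. *)
pose s := (b - q%:R) / (b - a).
have s01 : 0 <= s <= 1.
  by rewrite /s divr_ge0 ?ler_pdivrMr /=; lra.
have Pu : P M (s *: x + (1 - s) *: y).
  apply: face_base_polytope.
  have [u01 ur _] := iffLR (convex_setE _) (@convex_slab R n H _ _ _) x y s s01 sx sy.
  split => //; rewrite sum_conv -/a -/b.
  suff -> : s * a + (1 - s) * b = q%:R by rewrite lexx.
  by rewrite /s; field; lra.
(* From 1 - l = (1 - l') (1 - s), with 1 - s = (q - a) / (b - a); the hypothesis [zq] makes [l']
   nonnegative. *)
pose l' := 1 - (1 - l) * (b - a) / (q%:R - a).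
have -> : l *: x + (1 - l) *: y = l' *: x + (1 - l') *: (s *: x + (1 - s) *: y).
  apply/rowP => i; rewrite !mxE /l' /s; field; lra.
apply: (iffLR (convex_setE _) (@convex_hull_convex R n _)) => //.
have -> : l' = (q%:R - a - (1 - l) * (b - a)) / (q%:R - a).
  by rewrite /l'; field; lra.
rewrite divr_ge0 ?ler_pdivrMr ?mul1r /=; nra.
Qed.

(** If both ends satisfy x(H) <= r - 1, convexity of [P M] applies; if both satisfy x(H) > r - 1, so
    does the segment; mixed ends are the crossing case. *)
Lemma convex_relaxed_polytope : @convex_set R 'rV[R]_n relaxed_polytope.
Proof.
apply/convex_setE => x y l l01 Wx Wy.
have [[sx Px] [sy Py]] := (Wx, Wy).
split; first exact: (iffLR (convex_setE _) (@convex_slab R n H _ _ _)).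
move=> zq; have [xq|xq] := leP (\sum_(i in H) x 0 i) q%:R.
  have [yq|yq] := leP (\sum_(i in H) y 0 i) q%:R.
    apply: (iffLR (convex_setE _) (@convex_hull_convex R n _)) => //.
      exact: Px.
    exact: Py.
  exact: relaxed_polytope_cross.
have [yq|yq] := leP (\sum_(i in H) y 0 i) q%:R; last first.
  move: zq; rewrite sum_conv; move: l01 => /andP[l0 l1].
  have [->|l_neq0] := eqVneq l 0; first by lra.
  have : 0 < l * (\sum_(i in H) x 0 i - q%:R).
    by rewrite mulr_gt0 ?subr_gt0 // lt_neqAle eq_sym l_neq0.
  have : 0 <= (1 - l) * (\sum_(i in H) y 0 i - q%:R).
    by rewrite mulr_ge0 ?subr_ge0 // ltW.
  by lra.
have zE : l *: x + (1 - l) *: y = (1 - l) *: y + (1 - (1 - l)) *: x.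
  by rewrite subKr addrC.
rewrite zE; apply: relaxed_polytope_cross => //; last by rewrite -zE.
by lra.
Qed.

(** A new basis has |B| = |B :&: H| = r, so its indicator lies in the slice. Conversely, the part
    x(H) >= r - 1 of the hypersimplex has only bases of the relaxation as vertices: those with |B
    :&: H| = r - 1 by [stressed_basis], the others because they lie in [H]. *)
Lemma base_polytope_relaxation : P relM = relaxed_polytope.
Proof.
have relH B : B \in bases relM ->
    B \in bases M \/ [/\ B \subset H & #|B| = mrank M].
  by rewrite !inE => /orP[|/andP[? /eqP]]; [left | right].
apply/seteqP; split.
  apply: smallest_sub; first exact: convex_relaxed_polytope.
  move=> _ [B BN <-].
  have sB : slab H (mrank M) 0 (mrank M) (indicator R B).
    rewrite -mrank_relaxation; apply: base_polytope_slab => [B' B'N|].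
      by rewrite -(bases_card B'N) subset_leq_card // finset.subsetIl.
    by apply: sub_gen_smallest; exists B.
  split=> // Bq; case: (relH _ BN) => [BM|[BH cB]].
    by apply: sub_gen_smallest; exists B.
  move: Bq; rewrite sum_indicatorI (finset.setIidPl BH) cB ler_nat.
  by rewrite -(hyperplane_rank stressedH) ltnn.
move=> x [[x01 xr xH] Px].
have [/Px|xq] := leP (\sum_(i in H) x 0 i) q%:R.
  apply: smallest_sub; first exact: convex_hull_convex.
  by move=> _ [B BM <-]; apply: sub_gen_smallest; exists B => //=; rewrite inE BM.
apply: (@slab_base_polytope R n relM H q (mrank relM)); last first.
  rewrite mrank_relaxation; split => //.
  by move: xH => /andP[_ ->]; rewrite ltW.
rewrite mrank_relaxation => B cB /andP[]; rewrite leq_eqVlt => /orP[/eqP qB _|qB _].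
  rewrite inE (stressed_basis stressedH) //.
  by rewrite -qB (hyperplane_rank stressedH).
rewrite !inE cB eqxx andbT; apply/orP; right; apply/finset.setIidPl/eqP.
by rewrite eqEcard finset.subsetIl cB -(hyperplane_rank stressedH).
Qed.

End Relaxation.

(** * Lattice points gained by the relaxation *)

Section LatticePoints.
Variables (R : realType) (n : nat) (M : matroid n) (H : {set 'I_n}).
Hypotheses (stressedH : stressed_hyperplane M H) (le_r_H : (mrank M <= #|H|)%N).
Local Notation relM := (relaxation stressedH).
Local Notation P := (@base_polytope R n).
Local Notation q := (rank_of M H).

Definition slab_points t : {set {ffun 'I_n -> 'I_t.+1}} :=
  [set f : {ffun 'I_n -> 'I_t.+1} |
    (\sum_i f i == q.+1 * t)%N && (q * t < \sum_(i in H) f i)%N]%SET.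

Definition row_of_ffun t (f : {ffun 'I_n -> 'I_t.+1}) : 'rV[R]_n :=
  \row_i (f i : nat)%:R.

Lemma row_of_ffun_inj t : injective (@row_of_ffun t).
Proof.
move=> f g /rowP fg; apply/ffunP => i; apply/val_inj/eqP.
by have := fg i; rewrite !mxE => /eqP; rewrite eqr_nat.
Qed.

Lemma sum_row_of_ffun t (f : {ffun 'I_n -> 'I_t.+1}) (Q : pred 'I_n) :
  \sum_(i | Q i) row_of_ffun f 0 i = (\sum_(i | Q i) f i)%N%:R.
Proof. by rewrite natr_sum; apply: eq_bigr => i _; rewrite mxE. Qed.

Lemma sum_scale (Q : pred 'I_n) (a : R) (u : 'rV[R]_n) :
  \sum_(i | Q i) (a *: u) 0 i = a * \sum_(i | Q i) u 0 i.
Proof. by rewrite mulr_sumr; apply: eq_bigr => i _; rewrite mxE. Qed.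

Lemma integral_row_of_ffun t (v : 'rV[R]_n) : (forall i, v 0 i \is a Num.int) ->
  (forall i, 0 <= v 0 i <= t%:R) -> exists f, v = @row_of_ffun t f.
Proof.
move=> vint v0t; exists [ffun i => inord (Num.truncn (v 0 i))].
apply/rowP => i; rewrite mxE ffunE; have /andP[v0 vt] := v0t i.
have vnat : v 0 i \is a Num.nat by rewrite natrEint vint.
by rewrite inordK ?truncnK // ltnS -(ler_nat R) truncnK.
Qed.

Lemma lattice_points_relaxation (t : nat) :
  lattice_points (dilate t%:R (P relM)) =
  lattice_points (dilate t%:R (P M)) `|`
    [set row_of_ffun f | f in [set` slab_points t]].
Proof.
have rE := hyperplane_rank stressedH.
rewrite (base_polytope_relaxation R stressedH le_r_H).
apply/seteqP; split => v.
  move=> [[u [[u01 ur uH] Pu] <-] uint].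
  have [uq|uq] := leP (\sum_(i in H) u 0 i) q%:R.
    by left; split => //; exists u => //; apply: Pu.
  (* For [t = 0] the strict inequality leaves [slab_points] empty, and both dilates reduce to the
     origin. *)
  have [t0|t0] := posnP t.
    left; split => //; have /set0Pn[B BM] := bases_neq0 M.
    exists (indicator R B); last by rewrite t0 !scale0r.
    by apply: sub_gen_smallest; exists B.
  have [|f fE] := @integral_row_of_ffun t _ uint.
    move=> i; rewrite mxE; have /andP[u0 u1] := u01 i.
    by rewrite mulr_ge0 //= ler_piMr.
  right; exists f => //=; rewrite inE -!(eqr_nat R) -(ltr_nat R).
  rewrite -!sum_row_of_ffun -fE !sum_scale ur -rE !natrM !(mulrC t%:R) eqxx /=.
  by rewrite ltr_pM2r ?ltr0n.
case=> [[[u Pu <-] vint]|[f /= + <-]].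
  split => //; exists u => //.
  have [u01 ur uH] := base_polytope_hyperplane stressedH Pu.
  split=> //; split => //; apply/andP; split; first by case/andP: uH.
  by have /andP[_ uq] := uH; apply: le_trans uq _; rewrite ler_nat -rE.
rewrite inE => /andP[/eqP fr fH]; split; last by move=> i; rewrite mxE intr_nat.
have t0 : (0 < t)%N.
  case: t f fr fH => // f fr fH; move: fH; rewrite muln0 => fH.
  by rewrite big1 // in fH => i _; case: (f i) => -[].
have tR : t%:R != 0 :> R by rewrite pnatr_eq0 -lt0n.
exists (t%:R^-1 *: row_of_ffun f); last by rewrite scalerA mulfV // scale1r.
have fall : (\sum_(i in H) f i <= q.+1 * t)%N.
  by rewrite -fr [leqRHS](bigID (mem H)) leq_addr.
have fHq : q%:R < t%:R^-1 * (\sum_(i in H) f i)%N%:R :> R.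
  by rewrite mulrC ltr_pdivlMr ?ltr0n // -natrM ltr_nat.
have fHr : t%:R^-1 * (\sum_(i in H) f i)%N%:R <= q.+1%:R :> R.
  by rewrite mulrC ler_pdivrMr ?ltr0n // -natrM ler_nat.
split; last by rewrite sum_scale sum_row_of_ffun leNgt fHq.
split.
- move=> i; rewrite !mxE mulr_ge0 ?invr_ge0 //= mulrC ler_pdivrMr ?ltr0n //.
  by rewrite mul1r ler_nat -ltnS.
- by rewrite sum_scale sum_row_of_ffun fr natrM mulrC mulfK // rE.
by rewrite sum_scale sum_row_of_ffun -rE fHr mulr_ge0 ?invr_ge0.
Qed.

Lemma disjoint_lattice_points (t : nat) :
  lattice_points (dilate t%:R (P M)) `&`
    [set row_of_ffun f | f in [set` slab_points t]] = set0.
Proof.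
apply/seteqP; split => // v [[[u Pu <-] _] [f /= + fE]].
have [_ _ /andP[_ uq]] := base_polytope_hyperplane stressedH Pu.
rewrite inE -(ltr_nat R) -!sum_row_of_ffun fE sum_scale natrM mulrC => /andP[_].
by rewrite ltNge ler_wpM2l.
Qed.

End LatticePoints.

Unset Implicit Arguments.
Close Scope ring_scope.
Close Scope card_scope.
Close Scope classical_set_scope.

Theorem corollary5p10 (R : realType) (n r : nat) (M : matroid n)
    (rankM : mrank M = r) (H : {set 'I_n})
    (stressedH : stressed_hyperplane M H) (leq_r_H : r <= #|H|)
    (posM : ehrhart_positive R M) :
  ehrhart_positive R (relaxation stressedH).
Proof.
have le_r_H : (mrank M <= #|H|)%N by rewrite rankM.
have [p pE p0] := posM.
have H0 : (0 < #|H|)%N.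
  by apply: leq_trans le_r_H; rewrite -(hyperplane_rank stressedH).
have Hc0 := hyperplane_proper stressedH.
(* Both [H] and its complement are nonempty, so the predecessors are exact; the rank of [H] is r -
   1. *)
have [Q Q0 QE] := simplex_box_positive R #|~: H|.-1 #|H|.-1 (rank_of M H).
exists (p + Q)%R; last by move=> i; rewrite coefD addr_ge0.
move=> t; have [k kE pk] := pE t.
exists (k + #|slab_points M H t|)%N.
  rewrite lattice_points_relaxation //; apply: card_eq_setU kE _.
    exact: disjoint_lattice_points.
  by apply: card_eq_image_finset; apply: row_of_ffun_inj.
by rewrite hornerD pk QE natrD -(@count_box_slab R n H) ?prednK.
Qed.
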